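(* For each $\theta\in[0,1]$, the assignment $\odot^\theta$ defined below is an operator space tensor norm. That is, for all normed operator spaces $E,F$ the norms $(\odot^\theta)_k$, $k\in\mathbb N$, define an operator space structure on $E\otimes F$, the identity maps $E\otimes_{\mathrm{proj}}F\to E\otimes_{\odot^\theta}F\to E\otimes_{\min}F$ are complete contractions, and for all completely bounded $S:E_1\to E_2$, $T:F_1\to F_2$ one has $\|S\otimes T: E_1\otimes_{\odot^\theta}F_1\to E_2\otimes_{\odot^\theta}F_2\|_{cb}\le\|S\|_{cb}\|T\|_{cb}$.
   Context: Normed operator spaces are (not necessarily complete) vector spaces $E$ with norms on each $M_n(E)$ satisfying Ruan's axioms; $\|\cdot\|_{cb}$ is the completely bounded norm, and $E'$ carries the dual structure $M_n(E')=CB(E,M_n)$. For $\theta\in[0,1]$ and $j\in\mathbb N$ let $\odot^\theta_j:M_j\times M_j\to M_j$, $\odot^\theta_j(A,B)=(1-\theta)AB+\theta BA$, and let $\otimes_{\odot^\theta_j}:M_j(E)\times M_j(F)\to M_j(E\otimes F)$ be the bilinear map determined by $(a_1\otimes x,a_2\otimes y)\mapsto \odot^\theta_j(a_1,a_2)\otimes x\otimes y$. For $u\in M_k(E\otimes F)$ set $(\odot^\theta)_k(u)=\inf\{\|a\|\|v_1\|_{M_j(E)}\|v_2\|_{M_j(F)}\|b\|\}$, the infimum over all $j\in\mathbb N$ and decompositions $u=a\,\otimes_{\odot^\theta_j}(v_1,v_2)\,b$ with $a\in M_{k,j}$, $b\in M_{j,k}$, $v_1\in M_j(E)$, $v_2\in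 M_j(F)$. The minimal norm is $\min_n(u)=\sup\{\|(f\otimes g)_n(u)\|: f\in M_p(E'),g\in M_q(F'),\|f\|,\|g\|\le1\}$; the projective norm is $\mathrm{proj}_n(u)=\inf\{\|a\|\|x\|\|y\|\|b\|: u=a(x\otimes y)b,\ x\in M_p(E),y\in M_q(F),a\in M_{n,pq},b\in M_{pq,n}\}$. *)

(* Defs.v *)
From HB Require Import structures.
From mathcomp Require Import all_boot all_order all_algebra.
From mathcomp Require Import all_classical all_reals.
From mathcomp Require Import complex.
Set Implicit Arguments. Unset Strict Implicit. Unset Printing Implicit Defensive.
Import Order.TTheory GRing.Theory Num.Theory.
Local Open Scope ring_scope.
Local Open Scope classical_set_scope.

Section OpSpaces.
Variable R : realType.
Local Notation C := (R[i]).

Definition cabs (z : C) : R := Num.sqrt (complex.Re z ^+ 2 + complex.Im z ^+ 2).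

Definition l2norm n (x : 'cV[C]_n) : R := Num.sqrt (\sum_i cabs (x i 0) ^+ 2).

Definition opnorm m n (A : 'M[C]_(m, n)) : R :=
  sup [set l2norm (A *m x) | x in [set x : 'cV[C]_n | l2norm x <= 1]].

(** Kronecker-style flattening: a 4-index family F i j k l (i<m, j<n, k<p, l<q)
    becomes an (m*p) x (n*q) matrix, row index (i,k), column index (j,l). *)
Definition kron4 (V : nmodType) m n p q
    (F : 'I_m -> 'I_n -> 'I_p -> 'I_q -> V) : 'M[V]_(m * p, n * q) :=
  \matrix_(I, J) \sum_(i < m) \sum_(j < n) \sum_(k < p) \sum_(l < q)
     (if (I == mxvec_index i k) && (J == mxvec_index j l) then F i j k l else 0).

Definition flat m n p q (w : 'M['M[C]_(p, q)]_(m, n)) : 'M[C]_(m * p, n * q) :=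
  kron4 (fun i j k l => w i j k l).

Definition mnorms (V : Type) := forall n, 'M[V]_n -> R.

(** operator space structure of M_p (= M_p(C)): M_n(M_p) = M_{np} *)
Definition Mp_norms p : mnorms 'M[C]_p := fun n w => opnorm (flat w).
Arguments Mp_norms p : clear implicits.

Definition lmx (V : lmodType C) m n p (a : 'M[C]_(m, n)) (v : 'M[V]_(n, p))
  : 'M[V]_(m, p) := \matrix_(i, j) \sum_(k < n) a i k *: v k j.
Definition rmx (V : lmodType C) m n p (v : 'M[V]_(m, n)) (b : 'M[C]_(n, p))
  : 'M[V]_(m, p) := \matrix_(i, j) \sum_(k < n) b k j *: v i k.
Definition lrmx (V : lmodType C) m n p q (a : 'M[C]_(m, n)) (v : 'M[V]_(n, p))
  (b : 'M[C]_(p, q)) : 'M[V]_(m, q) := rmx (lmx a v) b.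

Definition mxscale (V : lmodType C) m n (a : 'M[C]_(m, n)) (t : V) : 'M[V]_(m, n) :=
  \matrix_(i, j) (a i j *: t).

(** Ruan's axioms for a family of matrix norms on the elements of V lying in
    the subspace S (S = predT: on all of V). *)
Definition opspace_on (V : lmodType C) (S : pred V) (N : mnorms V) : Prop :=
  [/\
      forall n (v w : 'M[V]_n), (forall i j, S (v i j)) -> (forall i j, S (w i j)) ->
        [/\ N n v = 0 -> v = 0,
            forall c : C, N n (map_mx (fun x => c *: x) v) = cabs c * N n v
          & N n (v + w) <= N n v + N n w],
      forall m n (a : 'M[C]_(m, n)) (v : 'M[V]_n) (b : 'M[C]_(n, m)),
        (forall i j, S (v i j)) ->
        N m (lrmx a v b) <= opnorm a * N n v * opnorm b
    &
      forall n m (v : 'M[V]_n) (w : 'M[V]_m),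
        (forall i j, S (v i j)) -> (forall i j, S (w i j)) ->
        N (n + m)%N (block_mx v 0 0 w) = Num.max (N n v) (N m w)].

Definition opspace (V : lmodType C) (N : mnorms V) := opspace_on predT N.

Definition cbounded_on (V W : lmodType C) (S : pred V) (NV : mnorms V)
    (NW : mnorms W) (T : V -> W) : Prop :=
  exists M : R, forall n (v : 'M[V]_n), (forall i j, S (v i j)) ->
    NW n (map_mx T v) <= M * NV n v.

Definition cbnorm_on (V W : lmodType C) (S : pred V) (NV : mnorms V)
    (NW : mnorms W) (T : V -> W) : R :=
  sup [set r | exists n (v : 'M[V]_n), [/\ forall i j, S (v i j),
          NV n v <= 1 & r = NW n (map_mx T v)]].

Definition cbounded V W NV NW T := @cbounded_on V W predT NV NW T.
Definition cbnorm V W NV NW T := @cbnorm_on V W predT NV NW T.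

Definition ccontraction_on (V W : lmodType C) (S : pred V) (NV : mnorms V)
    (NW : mnorms W) (T : V -> W) : Prop :=
  forall n (v : 'M[V]_n), (forall i j, S (v i j)) -> NW n (map_mx T v) <= NV n v.

(** ---------------- algebraic tensor product ----------------
    E (x) F is realised inside the space of functions on pairs (f,g) of
    linear functionals, x (x) y := ((f,g) |-> f x * g y) (and 0 on
    pairs of non-linear functions).  Since algebraic duals separate points,
    the span of these elementary tensors is (isomorphic to) E (x) F. *)
Definition islin (E : lmodType C) (f : E -> C) : Prop :=
  forall (c : C) (x y : E), f (c *: x + y) = c * f x + f y.

Definition tens (E F : lmodType C) := (E -> C) -> (F -> C) -> C.

Definition tens_el (E F : lmodType C) (x : E) (y : F) : tens E F :=
  fun f g => if `[< islin f /\ islin g >] then f x * g y else 0.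

(** the elements of E (x) F: the linear span of the elementary tensors *)
Definition intens (E F : lmodType C) : pred (tens E F) :=
  fun t => `[< forall P : tens E F -> Prop,
                 P 0 -> (forall x y, P (tens_el x y)) ->
                 (forall (c : C) u v, P u -> P v -> P (c *: u + v)) -> P t >].

(** S (x) T : E1 (x) F1 -> E2 (x) F2, characterised by x(x)y |-> Sx (x) Ty *)
Definition tensmap (E1 E2 F1 F2 : lmodType C) (S : E1 -> E2) (T : F1 -> F2)
  (t : tens E1 F1) : tens E2 F2 :=
  fun f g => if `[< islin f /\ islin g >] then t (f \o S) (g \o T) else 0.

Definition mxtens (E F : lmodType C) p q (x : 'M[E]_p) (y : 'M[F]_q)
  : 'M[tens E F]_(p * q) := kron4 (fun i j k l => tens_el (x i j) (y k l)).

Definition odot (theta : R) j (A B : 'M[C]_j) : 'M[C]_j :=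
  (1 - theta)%:C%C *: (A *m B) + theta%:C%C *: (B *m A).

(** the bilinear map (x)_{odot^theta_j} : M_j(E) x M_j(F) -> M_j(E (x) F),
    determined by (a1 (x) x, a2 (x) y) |-> odot(a1,a2) (x) x (x) y;
    written out on the matrix units: v1 = sum e_pq (x) v1_pq etc. *)
Definition otimes_odot (theta : R) (E F : lmodType C) j
    (v1 : 'M[E]_j) (v2 : 'M[F]_j) : 'M[tens E F]_j :=
  \sum_(p < j) \sum_(q < j) \sum_(r < j) \sum_(s < j)
     mxscale (odot theta (delta_mx p q) (delta_mx r s)) (tens_el (v1 p q) (v2 r s)).

Definition odot_norm (theta : R) (E F : lmodType C) (NE : mnorms E)
    (NF : mnorms F) : mnorms (tens E F) :=
  fun k u => inf [set r | exists j (a : 'M[C]_(k, j)) (v1 : 'M[E]_j)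
                   (v2 : 'M[F]_j) (b : 'M[C]_(j, k)),
                   u = lrmx a (otimes_odot theta v1 v2) b /\
                   r = opnorm a * NE j v1 * NF j v2 * opnorm b].

Definition proj_norm (E F : lmodType C) (NE : mnorms E) (NF : mnorms F)
  : mnorms (tens E F) :=
  fun n u => inf [set r | exists p q (x : 'M[E]_p) (y : 'M[F]_q)
                   (a : 'M[C]_(n, p * q)) (b : 'M[C]_(p * q, n)),
                   u = lrmx a (mxtens x y) b /\
                   r = opnorm a * NE p x * NF q y * opnorm b].

(** elements of the unit ball of M_p(E') = CB(E, M_p) *)
Definition dual_ball (E : lmodType C) (NE : mnorms E) p (f : E -> 'M[C]_p) : Prop :=
  [/\ linear f, cbounded NE (Mp_norms p) f & cbnorm NE (Mp_norms p) f <= 1].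

(** (f (x) g)(t) in M_{pq} for t in E (x) F, f : E -> M_p, g : F -> M_q:
    on x (x) y it gives the Kronecker product f(x) (x) g(y) *)
Definition dual_tens (E F : lmodType C) p q (f : E -> 'M[C]_p)
    (g : F -> 'M[C]_q) (t : tens E F) : 'M[C]_(p * q) :=
  kron4 (fun i j k l => t (fun x => f x i j) (fun y => g y k l)).

Definition min_norm (E F : lmodType C) (NE : mnorms E) (NF : mnorms F)
  : mnorms (tens E F) :=
  fun n u => sup [set r | exists p q (f : E -> 'M[C]_p) (g : F -> 'M[C]_q),
                   [/\ dual_ball NE f, dual_ball NF g &
                       r = opnorm (flat (map_mx (dual_tens f g) u))]].

End OpSpaces.
Arguments mnorms {R} V.

(* Main.v *)
Require Import Defs.
From HB Require Import structures.
From mathcomp Require Import all_boot all_order all_algebra.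
From mathcomp Require Import all_classical all_reals.
From mathcomp Require Import complex.
From mathcomp Require Import ring lra.
Set Implicit Arguments. Unset Strict Implicit. Unset Printing Implicit Defensive.
Import Order.TTheory GRing.Theory Num.Theory.
Local Open Scope ring_scope.
Local Open Scope classical_set_scope.

(** Writing [v1 . v2] for the matrix product over the tensor product, the bilinear
    map sends [(v1, v2)] to [(1 - theta) v1 . v2 + theta (v1 .^op v2)], so it turns
    direct sums into direct sums. Decompositions can be normalised to
    [|v1|, |v2| <= 1] and [|a|^2, |b|^2 <= r]; taking direct sums of normalised
    decompositions then gives the triangle inequality and the direct sum axiom.
    The projective norm dominates because [x (x) 1] and [1 (x) y] commute, so
    that their [odot]-product is [x (x) y]. The minimal norm is dominated because
    [f (x) g] turns [(1 - theta) v1 . v2 + theta (v1 .^op v2)] into a convex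
    combination of [A B] and [B A], with [A] and [B] the ampliations of [f(v1)]
    and [g(v2)]. Definiteness follows from the last point applied to scalar
    functionals: by Hahn-Banach bounded functionals separate the points of [E]
    and [F], hence, contracting one leg at a time, those of [E (x) F]. *)

(** [inf] and [sup] of the empty set are 0, so a lower bound for [odot_norm] or [proj_norm] is
    meaningless until some decomposition exists; [odot_repr] and [proj_repr] carry this fact, and
    membership of the entries in [intens] supplies it. Decompositions are controlled through the
    squares of [|a|] and [|b|] because squared norms of rows and columns add: radii [r] and [r']
    then give [r + r'], and the arithmetic-geometric mean inequality returns [|a| |b| <= r]. The
    images [A] and [B] of [v1] and [v2] both act on the leg [C^j] of [C^j (x) C^p (x) C^q], so they
    need not commute; but [A B] and [B A] obey the same bound [|A| |B|], and [0 <= theta <= 1] lets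
    it pass to the convex combination. To move operators between legs without casts of matrix
    dimensions, estimates are made for kernels over arbitrary finite types ([sqbounded]).
    Hahn-Banach only controls a functional at the first matrix level; Ruan's axioms make a
    contractive scalar functional completely contractive, which brings it into the unit ball of
    [M_1(E')]. *)

Section Cabs.
Variable R : realType.
Implicit Types z w : R[i].

Lemma cabsE z : cabs z = Normc.normc z.
Proof. by case: z. Qed.

Lemma cabs_ge0 z : 0 <= cabs z.
Proof. exact: sqrtr_ge0. Qed.

Lemma sqr_cabs z : cabs z ^+ 2 = complex.Re z ^+ 2 + complex.Im z ^+ 2.
Proof. by rewrite sqr_sqrtr // addr_ge0 // sqr_ge0. Qed.

Lemma cabs0 : cabs (0 : R[i]) = 0.
Proof. by rewrite cabsE Normc.normc0. Qed.

Lemma cabs1 : cabs (1 : R[i]) = 1.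
Proof. by rewrite cabsE Normc.normc1. Qed.

Lemma cabsM z w : cabs (z * w) = cabs z * cabs w.
Proof. by rewrite !cabsE Normc.normcM. Qed.

Lemma cabsV z : cabs z^-1 = (cabs z)^-1.
Proof. by rewrite !cabsE Normc.normcV. Qed.

Lemma cabsN z : cabs (- z) = cabs z.
Proof. by rewrite !cabsE normcN. Qed.

Lemma cabs_real (t : R) : cabs t%:C%C = `|t|.
Proof. by rewrite /cabs /= expr0n addr0 sqrtr_sqr. Qed.

Lemma cabs_eq0 z : cabs z = 0 -> z = 0.
Proof. by rewrite cabsE => /Normc.eq0_normc. Qed.

Lemma cabs_conj z : cabs (z^*)%C = cabs z.
Proof. by case: z => a b; rewrite /cabs /= sqrrN. Qed.

Lemma cabsD z w : cabs (z + w) <= cabs z + cabs w.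
Proof. by rewrite !cabsE le_normcD. Qed.

Lemma mulcconj z : (z^*)%C * z = (cabs z ^+ 2)%:C%C.
Proof.
rewrite sqr_cabs; case: z => a b.
by apply/eqP; rewrite eq_complex /=; apply/andP; split; apply/eqP; ring.
Qed.

End Cabs.

(** * Hahn-Banach *)

Section HahnBanach.
Variables (R : realType) (E : lmodType R[i]).
Implicit Types (p q h : E -> R) (x y : E) (t s : R).

(** Homogeneity is asked only as an inequality, which is what survives an infimum; [sublinearZ]
    recovers equality by scaling back with [t^-1]. *)
Definition sublinear p : Prop :=
  (forall x y, p (x + y) <= p x + p y) /\
  (forall t x, 0 <= t -> p (t%:C%C *: x) <= t * p x).

Lemma sublinear0 p : sublinear p -> p 0 = 0.
Proof.
move=> [pD pZ]; apply/eqP; rewrite eq_le; apply/andP; split.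
  by have := pZ 0 0 (lexx _); rewrite scaler0 mul0r.
by have := pD 0 0; rewrite addr0; lra.
Qed.

Lemma sublinearZ p t x : sublinear p -> 0 <= t -> p (t%:C%C *: x) = t * p x.
Proof.
move=> pS t0; apply/eqP; rewrite eq_le pS.2 //=.
have [->|tn0] := eqVneq t 0; first by rewrite mul0r scale0r sublinear0.
have tp : 0 < t by rewrite lt0r tn0.
have := pS.2 t^-1 (t%:C%C *: x).
rewrite scalerA -rmorphM /= mulVf // scale1r invr_ge0 => /(_ t0).
by rewrite ler_pdivlMl.
Qed.

(** For sublinear [p], this is the largest sublinear functional below [p] whose value at [- y] is at
    most [- p y]. A linear functional below it is therefore forced to reach [p y] at [y]. *)
Definition tilt p y x : R :=
  inf [set p (x + t%:C%C *: y) - t * p y | t in [set t : R | 0 <= t]].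

Section Tilt.
Variables (p : E -> R) (y : E).
Hypothesis pS : sublinear p.

Lemma tilt_lb x t : 0 <= t -> - p (- x) <= p (x + t%:C%C *: y) - t * p y.
Proof.
move=> t0; rewrite -(sublinearZ y pS t0).
have := pS.1 (x + t%:C%C *: y) (- x).
by rewrite addrAC subrr add0r; lra.
Qed.

Lemma tilt_le x t : 0 <= t -> tilt p y x <= p (x + t%:C%C *: y) - t * p y.
Proof.
move=> t0; apply: ge_inf; last by exists t.
by exists (- p (- x)) => _ [s s0 <-]; apply: tilt_lb.
Qed.

Lemma le_tilt x m :
  (forall t, 0 <= t -> m <= p (x + t%:C%C *: y) - t * p y) -> m <= tilt p y x.
Proof.
move=> H; apply: lb_le_inf; last by move=> _ [t t0 <-]; apply: H.
by exists (p (x + 0%:C%C *: y) - 0 * p y), 0 => /=.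
Qed.

Lemma tilt_le_id x : tilt p y x <= p x.
Proof.
have := tilt_le x (lexx 0).
by rewrite rmorph0 scale0r addr0 mul0r subr0.
Qed.

Lemma tilt_opp : tilt p y (- y) <= - p y.
Proof.
have := tilt_le (- y) (@ler01 R).
by rewrite rmorph1 scale1r addNr sublinear0 // mul1r sub0r.
Qed.

Lemma sublinear_tilt : sublinear (tilt p y).
Proof.
split=> [x x'|t x].
  rewrite -lerBlDr; apply: le_tilt => t t0.
  rewrite lerBlDr -lerBlDl; apply: le_tilt => s s0.
  rewrite lerBlDl.
  (* Parameters [t] for [x] and [s] for [x'] are answered by [t + s] for [x + x']. *)
  have ts0 : 0 <= t + s by rewrite addr_ge0.
  have := tilt_le (x + x') ts0.
  have := pS.1 (x + t%:C%C *: y) (x' + s%:C%C *: y).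
  rewrite addrACA -scalerDl -rmorphD /=; lra.
rewrite le_eqVlt => /predU1P[<-|tp].
  rewrite rmorph0 scale0r mul0r.
  by have := tilt_le_id 0; rewrite (sublinear0 pS).
rewrite -ler_pdivrMl //; apply: le_tilt => s s0.
rewrite ler_pdivrMl //.
have ts0 : 0 <= t * s by rewrite mulr_ge0 // ltW.
apply: (le_trans (tilt_le _ ts0)).
rewrite (rmorphM (real_complex R)) -scalerA -scalerDr (sublinearZ _ pS (ltW tp)).
by rewrite mulrBr mulrA.
Qed.

End Tilt.

(** Zorn's lemma, with the pointwise infimum as the bound of a chain; it is finite since every
    sublinear [q] below [p] satisfies [- p (- x) <= q x]. *)
Lemma exists_minimal_sublinear p : sublinear p ->
  exists2 h, sublinear h /\ (forall x, h x <= p x) &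
    forall q, sublinear q -> (forall x, q x <= h x) -> q = h.
Proof.
move=> pS.
pose T := {q : E -> R | sublinear q /\ forall x, q x <= p x}.
(* The order is reversed, so that the maximal element given by [Zorn] is a minimal functional. *)
pose le (q q' : T) := `[< forall x, sval q' x <= sval q x >].
have lb (q : T) x : - p (- x) <= sval q x.
  case: q => q /= [qS qp]; have := qS.1 x (- x); rewrite subrr sublinear0 //.
  by have := qp (- x); lra.
have [| | | |h hmin] := @Zorn T le.
- by move=> t; apply/asboolP.
- move=> r s t /asboolP rs /asboolP st; apply/asboolP => x.
  exact: le_trans (st x) (rs x).
- move=> [s Ps] [t Pt] /asboolP /= st /asboolP /= ts.
  apply: eq_exist; apply: funext => x; apply/eqP.
  by rewrite eq_le st ts.
- move=> A Atot; have [A0|/set0P[q0 Aq0]] := eqVneq A set0.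
    exists (exist _ p (conj pS (fun x => lexx (p x)))) => s.
    by rewrite A0.
  pose m x := inf [set sval q x | q in A].
  have mle (q : T) x : A q -> m x <= sval q x.
    move=> Aq; apply: ge_inf; last by exists q.
    by exists (- p (- x)) => _ [s _ <-]; apply: lb.
  have lem a x : (forall q : T, A q -> a <= sval q x) -> a <= m x.
    move=> H; apply: lb_le_inf; last by move=> _ [s As <-]; apply: H.
    by exists (sval q0 x), q0.
  have mS : sublinear m.
    split=> [x y|t x].
      rewrite -lerBlDr; apply: (lem) => q Aq.
      rewrite lerBlDr -lerBlDl; apply: (lem) => r Ar.
      rewrite lerBlDl.
      have [/asboolP|/asboolP] := Atot _ _ Aq Ar => H.
        apply: (le_trans (mle r _ Ar)); apply: (le_trans ((svalP r).1.1 _ _)).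
        by have := H x; lra.
      apply: (le_trans (mle q _ Aq)); apply: (le_trans ((svalP q).1.1 _ _)).
      by have := H y; lra.
    rewrite le_eqVlt => /predU1P[<-|tp].
      rewrite rmorph0 scale0r mul0r.
      by have := mle q0 0 Aq0; rewrite (sublinear0 (svalP q0).1).
    rewrite -ler_pdivrMl //; apply: (lem) => q Aq; rewrite ler_pdivrMl //.
    by apply: (le_trans (mle q _ Aq)); apply: (svalP q).1.2; exact: ltW.
  have mp x : m x <= p x := le_trans (mle q0 x Aq0) ((svalP q0).2 x).
  by exists (exist _ m (conj mS mp)) => s As; apply/asboolP => x /=; apply: mle.
- exists (sval h); first exact: svalP h.
  move=> q qS qh.
  have qp x : q x <= p x := le_trans (qh x) ((svalP h).2 x).
  have := hmin (exist _ q (conj qS qp)).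
  by move=> H; rewrite -H //; apply/asboolP.
Qed.

(* A minimal sublinear functional [h] equals each of its tilts, which forces
   [h x + h y <= h (x + y)]. *)
Lemma sublinear_dominates_linear p : sublinear p ->
  exists h, [/\ forall x y, h (x + y) = h x + h y,
                forall t x, h (t%:C%C *: x) = t * h x
              & forall x, h x <= p x].
Proof.
move=> pS; have [h [hS hp] hmin] := exists_minimal_sublinear pS.
have hD x y : h (x + y) = h x + h y.
  apply/eqP; rewrite eq_le hS.1 /=.
  rewrite -[h in h x](hmin (tilt h y)); last 2 first.
  - exact: sublinear_tilt.
  - exact: tilt_le_id.
  by have := tilt_le y hS x (@ler01 R); rewrite rmorph1 scale1r mul1r; lra.
have hN x : h (- x) = - h x.
  by have := hD x (- x); rewrite subrr sublinear0 //; lra.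
exists h; split => // t x; have [t0|t0] := lerP 0 t; first exact: sublinearZ.
rewrite -[t]opprK rmorphN scaleNr hN sublinearZ ?mulNr //.
by rewrite oppr_ge0 ltW.
Qed.

(** A real-linear [h] below [tilt p x0] is below [p] and satisfies [p x0 <= h x0]; [h] is then taken
    as the real part of [f]. *)
Lemma hahn_banach_separation p (x0 : E) :
    (forall x y, p (x + y) <= p x + p y) ->
    (forall (c : R[i]) x, p (c *: x) = cabs c * p x) ->
  exists f : E -> R[i],
    [/\ islin f, forall x, cabs (f x) <= p x & f x0 = 0 -> p x0 <= 0].
Proof.
move=> pD pZ.
have pS : sublinear p.
  by split=> // t x t0; rewrite pZ cabs_real ger0_norm.
have [h [hD hZ hp]] := sublinear_dominates_linear (sublinear_tilt x0 pS).
have hlep x : h x <= p x := le_trans (hp x) (tilt_le_id _ pS _).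
have hN x : h (- x) = - h x.
  by rewrite -scaleN1r -[-1 : R[i]](rmorphN1 (real_complex R)) hZ mulN1r.
(* The only complex-linear functional with real part [h]. *)
pose f x := (h x -i* h ('i%C *: x))%C.
have fD x y : f (x + y) = f x + f y.
  by apply/eqP; rewrite eq_complex /= scalerDr !hD opprD !eqxx.
have fZ c x : f (c *: x) = c * f x.
  case: c => a b.
  have -> : (a +i* b)%C = a%:C%C + b%:C%C * 'i%C :> R[i].
    by apply/eqP; rewrite eq_complex /=; apply/andP; split; apply/eqP; ring.
  apply/eqP; rewrite eq_complex /f /=.
  rewrite scalerDl hD scalerDr hD -!scalerA !hZ.
  rewrite ['i%C *: (a%:C%C *: _)]scalerA [_ * a%:C%C]mulrC -scalerA hZ.
  rewrite ['i%C *: (b%:C%C *: _)]scalerA [_ * b%:C%C]mulrC -scalerA hZ.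
  have -> : 'i%C *: ('i%C *: x) = - x by rewrite scalerA -expr2 sqr_i scaleN1r.
  rewrite hN.
  by apply/andP; split; apply/eqP; ring.
exists f; split.
- by move=> c x y; rewrite fD fZ.
- move=> x.
  have [->|nz] := eqVneq (cabs (f x)) 0.
    by have := hlep x; have := hlep (- x); rewrite hN -scaleN1r pZ cabsN cabs1; lra.
  have fp : 0 < cabs (f x) by rewrite lt0r nz cabs_ge0.
  (* Multiplying [x] by the conjugate of [f x] makes the value of [f] real, equal to [|f x|^2], so
     the bound on the real part [h] applies; one factor [|f x|] is then cancelled. *)
  rewrite -(ler_pM2l fp) -[cabs (f x) in X in _ <= X * _]cabs_conj -pZ.
  apply: le_trans (hlep _).
  have -> : h ((f x)^*%C *: x) = complex.Re (f ((f x)^*%C *: x)) by [].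
  by rewrite fZ mulcconj /= expr2.
- move=> /(congr1 (@complex.Re R)) /= h0.
  by have := le_trans (hp (- x0)) (tilt_opp x0 pS); rewrite hN h0; lra.
Qed.

End HahnBanach.

(** * Square-summable kernels and the operator norm *)

Section SquareBounds.
Variable R : realType.
Local Notation C := R[i].

Lemma eq_ler (x y : R) : x = y -> x <= y.
Proof. by move->. Qed.

Lemma sum_pair (V : nmodType) (I J : finType) (F : I * J -> V) :
  \sum_p F p = \sum_i \sum_j F (i, j).
Proof. by rewrite pair_bigA; apply: eq_bigr => -[]. Qed.

(** Lagrange's identity: the double sum of [(a i * b j - a j * b i) ^+ 2] is twice the difference of
    the two sides. *)
Lemma cauchy_schwarz_sum (I : finType) (a b : I -> R) :
  (\sum_i a i * b i) ^+ 2 <= (\sum_i a i ^+ 2) * (\sum_i b i ^+ 2).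
Proof.
set P := \sum_i a i * b i; set S := \sum_i _; set T := \sum_i _.
have : 0 <= \sum_i \sum_j (a i * b j - a j * b i) ^+ 2.
  by apply: sumr_ge0 => i _; apply: sumr_ge0 => j _; apply: sqr_ge0.
suff -> : \sum_i \sum_j (a i * b j - a j * b i) ^+ 2 = S * T - 2 * P * P + T * S.
  lra.
rewrite {1}/S {2}/P {2}/T mulr_suml mulr_sumr mulr_suml -sumrB -big_split /=.
apply: eq_bigr => i _.
rewrite /T /P /S !mulr_sumr mulr_suml -sumrB -big_split /=.
by apply: eq_bigr => j _; ring.
Qed.

Lemma cabs_sum (I : finType) (F : I -> C) : cabs (\sum_i F i) <= \sum_i cabs (F i).
Proof.
elim/big_ind2: _ => [|x1 x2 y1 y2 h1 h2|//]; first by rewrite cabs0.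
by apply: (le_trans (cabsD _ _)); apply: lerD.
Qed.

Lemma cauchy_schwarz_cabs (I : finType) (a b : I -> C) :
  cabs (\sum_i a i * b i) ^+ 2 <=
  (\sum_i cabs (a i) ^+ 2) * (\sum_i cabs (b i) ^+ 2).
Proof.
apply: le_trans (cauchy_schwarz_sum _ _).
rewrite lerXn2r ?nnegrE ?cabs_ge0 ?sumr_ge0 // => [i _|].
  by rewrite mulr_ge0 ?cabs_ge0.
by apply: (le_trans (cabs_sum _)); apply: ler_sum => i _; rewrite cabsM.
Qed.

Lemma sumsq_ge0 (I : finType) (x : I -> C) : 0 <= \sum_i cabs (x i) ^+ 2.
Proof. by apply: sumr_ge0 => i _; apply: sqr_ge0. Qed.

(** [M] bounds the square of the operator norm. The index types are arbitrary so that products and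
    reindexings need no flattening. *)
Definition sqbounded (I J : finType) (K : I -> J -> C) (M : R) : Prop :=
  forall x : J -> C,
    \sum_i cabs (\sum_j K i j * x j) ^+ 2 <= M * \sum_j cabs (x j) ^+ 2.

Section Kernels.
Variables I J L : finType.

Lemma eq_sqbounded (K K' : I -> J -> C) M :
  (forall i j, K i j = K' i j) -> sqbounded K M -> sqbounded K' M.
Proof.
move=> e KM x; rewrite (eq_bigr (fun i => cabs (\sum_j K i j * x j) ^+ 2)) //.
by move=> i _; congr (cabs _ ^+ 2); apply: eq_bigr => j _; rewrite e.
Qed.

Lemma sqbounded_le (K : I -> J -> C) M M' :
  M <= M' -> sqbounded K M -> sqbounded K M'.
Proof.
by move=> MM KM x; apply: (le_trans (KM x)); rewrite ler_wpM2r ?sumsq_ge0.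
Qed.

Lemma sqbounded_sumsq (K : I -> J -> C) :
  sqbounded K (\sum_i \sum_j cabs (K i j) ^+ 2).
Proof.
by move=> x; rewrite mulr_suml; apply: ler_sum => i _; apply: cauchy_schwarz_cabs.
Qed.

Lemma sqbounded_comp (K : I -> J -> C) (K' : J -> L -> C) M M' :
  0 <= M -> sqbounded K M -> sqbounded K' M' ->
  sqbounded (fun i l => \sum_j K i j * K' j l) (M * M').
Proof.
move=> M0 KM KM' x.
rewrite (eq_bigr (fun i => cabs (\sum_j K i j * (\sum_l K' j l * x l)) ^+ 2)).
  apply: (le_trans (KM _)); rewrite -mulrA; apply: ler_wpM2l => //; exact: KM'.
move=> i _; congr (cabs _ ^+ 2).
under eq_bigr do rewrite mulr_suml.
rewrite exchange_big; apply: eq_bigr => j _; rewrite mulr_sumr.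
by apply: eq_bigr => l _; rewrite mulrA.
Qed.

(** The kernel of [K (x) 1] splits into independent copies of [K], one for each value of the second
    index. *)
Lemma sqbounded_amplify (K : I -> J -> C) M :
  sqbounded K M ->
  sqbounded (fun (i : I * L) (j : J * L) => K i.1 j.1 * (i.2 == j.2)%:R) M.
Proof.
move=> KM x.
rewrite !sum_pair.
rewrite exchange_big [X in _ <= _ * X]exchange_big /= mulr_sumr.
apply: ler_sum => l _; apply: le_trans (KM _).
apply: eq_ler.
apply: eq_bigr => i _; congr (cabs _ ^+ 2).
rewrite sum_pair.
apply: eq_bigr => j _; rewrite (bigD1 l) //= eqxx mulr1 big1 ?addr0 // => l'.
by rewrite eq_sym => /negbTE ->; rewrite mulr0 mul0r.
Qed.

(** Convexity of the squared modulus, applied to each output coordinate; the defect for real numbers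
    is [t * (1 - t) * (u - v) ^+ 2]. *)
Lemma sqbounded_convex (K K' : I -> J -> C) (t M : R) :
  0 <= t <= 1 -> sqbounded K M -> sqbounded K' M ->
  sqbounded (fun i j => (1 - t)%:C%C * K i j + t%:C%C * K' i j) M.
Proof.
move=> /andP[t0 t1] KM KM' x.
set X := (X in _ <= M * X).
have -> : M * X = (1 - t) * (M * X) + t * (M * X) by ring.
have t1' : 0 <= 1 - t by lra.
apply: le_trans (lerD (ler_wpM2l t1' (KM x)) (ler_wpM2l t0 (KM' x))).
rewrite !mulr_sumr -big_split; apply: ler_sum => i _ /=.
under eq_bigr do rewrite mulrDl -!mulrA.
rewrite big_split -!mulr_sumr /=.
set z := \sum_j _; set w := \sum_j _.
rewrite !sqr_cabs; case: z w => [a b] [c d] /=.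
rewrite !mul0r !subr0 !addr0.
have h (u v : R) : ((1 - t) * u + t * v) ^+ 2 <= (1 - t) * u ^+ 2 + t * v ^+ 2.
  have : 0 <= t * (1 - t) * (u - v) ^+ 2 by rewrite mulr_ge0 ?sqr_ge0 // mulr_ge0.
  by move=> e; rewrite -subr_ge0; apply: (le_trans e); apply: eq_ler; ring.
by have := h a c; have := h b d; lra.
Qed.

End Kernels.

(** The input is extended by zero outside the image of [g], and the output rows outside the image of
    [f] are dropped. *)
Lemma sqbounded_sub (I J I' J' : finType) (f : I' -> I) (g : J' -> J)
    (K : I -> J -> C) M :
  injective f -> injective g ->
  sqbounded K M -> sqbounded (fun i j => K (f i) (g j)) M.
Proof.
move=> fI gI KM x.
pose y j := if [pick j' | g j' == j] is Some j' then x j' else 0.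
have yg j' : y (g j') = x j'.
  rewrite /y; case: pickP => [k /eqP/gI -> //|/(_ j')].
  by rewrite eqxx.
have y0 j : j \notin g @: predT -> y j = 0.
  rewrite /y; case: pickP => // k /eqP <- /negP[]; exact: imset_f.
have sumg (V : nmodType) (F : J -> V) :
    (forall j, j \notin g @: predT -> F j = 0) -> \sum_j F j = \sum_j' F (g j').
  move=> F0; rewrite (bigID (mem (g @: predT))) /= [X in _ + X]big1 // addr0.
  rewrite big_imset /=; last by move=> ? ? _ _ /gI.
  by apply: eq_bigl => j; rewrite inE.
have := KM y; rewrite [X in _ <= _ * X]sumg; last first.
  by move=> j /y0 ->; rewrite cabs0 expr0n.
rewrite [X in _ <= _ * X](eq_bigr (fun j => cabs (x j) ^+ 2)); last first.
  by move=> j _; rewrite yg.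
apply: le_trans.
rewrite [X in _ <= X](bigID (mem (f @: predT))) /= ler_wpDr ?sumr_ge0 //.
  by move=> i _; apply: sqr_ge0.
rewrite big_imset /=; last by move=> ? ? _ _ /fI.
apply: eq_ler.
apply: eq_big => [i|i _]; first by rewrite inE.
congr (cabs _ ^+ 2); rewrite sumg; last by move=> j /y0 ->; rewrite mulr0.
by apply: eq_bigr => j _; rewrite yg.
Qed.

Lemma sqbounded_delta (I : finType) :
  sqbounded (fun i j : I => (i == j)%:R) 1.
Proof.
move=> x; rewrite mul1r; apply: eq_ler.
apply: eq_bigr => i _; congr (cabs _ ^+ 2).
rewrite (bigD1 i) //= eqxx mul1r big1 ?addr0 // => j.
by rewrite eq_sym => /negbTE ->; rewrite mul0r.
Qed.

End SquareBounds.

Section OperatorNorm.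
Variable R : realType.
Local Notation C := R[i].

Lemma sqr_l2norm n (x : 'cV[C]_n) : l2norm x ^+ 2 = \sum_i cabs (x i 0) ^+ 2.
Proof. by rewrite sqr_sqrtr // sumsq_ge0. Qed.

Lemma l2norm_ge0 n (x : 'cV[C]_n) : 0 <= l2norm x.
Proof. exact: sqrtr_ge0. Qed.

Lemma l2norm0 n : l2norm (0 : 'cV[C]_n) = 0.
Proof.
by rewrite /l2norm big1 ?sqrtr0 // => i _; rewrite mxE cabs0 expr0n.
Qed.

Lemma l2normZ n (c : C) (x : 'cV[C]_n) : l2norm (c *: x) = cabs c * l2norm x.
Proof.
apply/eqP; rewrite -(@eqrXn2 _ 2) ?mulr_ge0 ?l2norm_ge0 ?cabs_ge0 //.
rewrite exprMn !sqr_l2norm mulr_sumr; apply/eqP.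
by apply: eq_bigr => i _; rewrite mxE cabsM exprMn.
Qed.

Section Opnorm.
Variables (m n : nat) (A : 'M[C]_(m, n)).

Lemma sqbounded_l2norm M x : sqbounded A M ->
  l2norm (A *m x) ^+ 2 <= M * l2norm x ^+ 2.
Proof.
move=> AM; rewrite !sqr_l2norm.
by under eq_bigr do rewrite mxE; apply: (AM (fun j => x j 0)).
Qed.

Lemma opnorm_has_ubound :
  has_ubound [set l2norm (A *m x) | x in [set x : 'cV[C]_n | l2norm x <= 1]].
Proof.
pose M := \sum_i \sum_j cabs (A i j) ^+ 2.
have M0 : 0 <= M by apply: sumr_ge0 => i _; apply: sumsq_ge0.
(* [M] bounds the square of the norm; [1 + M] dominates its square root. *)
exists (1 + M) => _ [x /= x1 <-].
have := sqbounded_l2norm x (sqbounded_sumsq (A : 'I_m -> 'I_n -> C)).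
rewrite -/M; have := l2norm_ge0 x; have := l2norm_ge0 (A *m x).
set a := l2norm _; set b := l2norm x in x1 *.
move=> a0 b0 h.
have : a ^+ 2 <= M by apply: le_trans h _; rewrite ler_piMr // expr_le1.
by move=> ?; nra.
Qed.

Lemma opnorm_ge0 : 0 <= opnorm A.
Proof.
apply: ub_le_sup; first exact: opnorm_has_ubound.
by exists 0 => /=; rewrite ?mulmx0 l2norm0.
Qed.

Lemma l2norm_mulmx_le x : l2norm (A *m x) <= opnorm A * l2norm x.
Proof.
have [x0|x0] := eqVneq (l2norm x) 0.
  have : l2norm (A *m x) ^+ 2 <= 0.
    have := sqbounded_l2norm x (sqbounded_sumsq (A : 'I_m -> 'I_n -> C)).
    by rewrite x0 expr0n mulr0.
  by have := l2norm_ge0 (A *m x); rewrite x0; nra.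
have xp : 0 < l2norm x by rewrite lt0r x0 l2norm_ge0.
rewrite -ler_pdivrMr // mulrC.
have nV : cabs (l2norm x)^-1%:C%C = (l2norm x)^-1.
  by rewrite cabs_real ger0_norm // invr_ge0 ltW.
apply: ub_le_sup; first exact: opnorm_has_ubound.
exists ((l2norm x)^-1%:C%C *: x) => /=.
  by rewrite l2normZ nV mulVf.
by rewrite -scalemxAr l2normZ nV.
Qed.

Lemma opnorm_sqbounded : sqbounded A (opnorm A ^+ 2).
Proof.
move=> x; have := l2norm_mulmx_le (\col_j x j).
rewrite -ler_sqr ?nnegrE ?mulr_ge0 ?l2norm_ge0 ?opnorm_ge0 //.
rewrite exprMn !sqr_l2norm.
under eq_bigr do rewrite mxE.
under [X in _ <= _ * X -> _]eq_bigr do rewrite mxE.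
by under eq_bigr do under eq_bigr do rewrite mxE.
Qed.

Lemma sqbounded_opnorm M : 0 <= M -> sqbounded A (M ^+ 2) -> opnorm A <= M.
Proof.
move=> M0 AM; apply: ge_sup.
  by exists 0, 0 => /=; rewrite ?mulmx0 l2norm0.
move=> _ [x /= x1 <-]; have := sqbounded_l2norm x AM.
rewrite -exprMn ler_sqr ?nnegrE ?mulr_ge0 ?l2norm_ge0 // => h.
by apply: (le_trans h); rewrite ler_piMr.
Qed.

Lemma sqbounded_sqr_opnorm M : 0 <= M -> sqbounded A M -> opnorm A ^+ 2 <= M.
Proof.
move=> M0 AM; rewrite -[M]sqr_sqrtr // lerXn2r ?nnegrE ?sqrtr_ge0 ?opnorm_ge0 //.
by apply: sqbounded_opnorm; rewrite ?sqrtr_ge0 ?sqr_sqrtr.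
Qed.

Lemma opnorm_le0_eq0 : opnorm A <= 0 -> A = 0.
Proof.
move=> A0; have {A0}A0 : opnorm A = 0 by apply/eqP; rewrite eq_le A0 opnorm_ge0.
apply/matrixP => i j.
have := l2norm_mulmx_le (delta_mx j 0); rewrite A0 mul0r => h.
have : l2norm (A *m delta_mx j 0) ^+ 2 <= 0.
  by have := l2norm_ge0 (A *m delta_mx j (0 : 'I_1)); nra.
rewrite sqr_l2norm (bigD1 i) //= -colE mxE => h2; rewrite [RHS]mxE.
apply: cabs_eq0; apply/eqP; rewrite -sqrf_eq0; apply/eqP.
have : 0 <= \sum_(k < m | k != i) cabs (col j A k 0) ^+ 2.
  by apply: sumr_ge0 => k _; apply: sqr_ge0.
by move: h2; have := sqr_ge0 (cabs (A i j)); lra.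
Qed.

End Opnorm.

Lemma opnorm_mul m n p (A : 'M[C]_(m, n)) (B : 'M[C]_(n, p)) :
  opnorm (A *m B) <= opnorm A * opnorm B.
Proof.
apply: sqbounded_opnorm; first by rewrite mulr_ge0 ?opnorm_ge0.
rewrite exprMn.
apply: eq_sqbounded (sqbounded_comp (sqr_ge0 _) (opnorm_sqbounded A) (opnorm_sqbounded B)).
by move=> i j; rewrite mxE.
Qed.

Lemma opnormZ m n (c : C) (A : 'M[C]_(m, n)) : opnorm (c *: A) <= cabs c * opnorm A.
Proof.
apply: sqbounded_opnorm; first by rewrite mulr_ge0 ?opnorm_ge0 ?cabs_ge0.
move=> x; rewrite exprMn -mulrA.
apply: le_trans (ler_wpM2l (sqr_ge0 _) (opnorm_sqbounded A x)).
rewrite mulr_sumr; apply: ler_sum => i _.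
rewrite -exprMn -cabsM mulr_sumr; apply: eq_ler.
by congr (cabs _ ^+ 2); apply: eq_bigr => j _; rewrite mxE mulrA.
Qed.

Lemma opnorm1 n : opnorm (1%:M : 'M[C]_n) <= 1.
Proof.
apply: sqbounded_opnorm => //; rewrite expr1n.
apply: eq_sqbounded; last exact: sqbounded_delta.
by move=> i j; rewrite mxE.
Qed.

Lemma opnorm_col_le n (x : 'cV[C]_n) : opnorm x <= l2norm x.
Proof.
apply: sqbounded_opnorm; first exact: l2norm_ge0.
move=> y; rewrite sqr_l2norm big_ord1 mulr_suml; apply: ler_sum => i _.
by rewrite big_ord1 cabsM exprMn.
Qed.

Lemma opnorm_row_le n (x : 'rV[C]_n) : opnorm x <= l2norm x^T.
Proof.
apply: sqbounded_opnorm; first exact: l2norm_ge0.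
move=> y; rewrite sqr_l2norm big_ord1; under [X in _ <= X * _]eq_bigr do rewrite mxE.
exact: cauchy_schwarz_cabs.
Qed.

Lemma sqbounded_block m n p q (a : 'M[C]_(m, n)) (b : 'M[C]_(p, q)) M :
  sqbounded a M -> sqbounded b M -> sqbounded (block_mx a 0 0 b) M.
Proof.
move=> aM bM x; rewrite !big_split_ord mulrDr /=; apply: lerD.
  apply: le_trans (aM _); apply: eq_ler.
  apply: eq_bigr => i _; congr (cabs _ ^+ 2); rewrite big_split_ord /= [X in _ + X]big1.
    by rewrite addr0; apply: eq_bigr => j _; rewrite block_mxEul.
  by move=> j _; rewrite block_mxEur mxE mul0r.
apply: le_trans (bM _); apply: eq_ler.
apply: eq_bigr => i _; congr (cabs _ ^+ 2); rewrite big_split_ord /= [X in X + _]big1.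
  by rewrite add0r; apply: eq_bigr => j _; rewrite block_mxEdr.
by move=> j _; rewrite block_mxEdl mxE mul0r.
Qed.

Lemma sqbounded_col m n q (a : 'M[C]_(m, n)) (b : 'M[C]_(q, n)) M M' :
  sqbounded a M -> sqbounded b M' -> sqbounded (col_mx a b) (M + M').
Proof.
move=> aM bM x; rewrite big_split_ord mulrDl /=; apply: lerD.
  by apply: le_trans (aM x); under eq_bigr do under eq_bigr do rewrite col_mxEu.
by apply: le_trans (bM x); under eq_bigr do under eq_bigr do rewrite col_mxEd.
Qed.

(* Weighted Young inequality [|z + w|^2 <= (1 + M'/M) |z|^2 + (1 + M/M') |w|^2]. *)
Lemma sqbounded_row m n q (a : 'M[C]_(m, n)) (b : 'M[C]_(m, q)) M M' :
  0 < M -> 0 < M' ->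
  sqbounded a M -> sqbounded b M' -> sqbounded (row_mx a b) (M + M').
Proof.
move=> M0 M'0 aM bM x; rewrite big_split_ord mulrDr /=.
set X := (X in _ <= _ * X + _); set Y := (X in _ <= _ + _ * X).
have k1 : 0 <= (M + M') / M by rewrite divr_ge0 ?addr_ge0 // ltW.
have k2 : 0 <= (M + M') / M' by rewrite divr_ge0 ?addr_ge0 // ltW.
have -> : (M + M') * X = (M + M') / M * (M * X) by field; rewrite gt_eqF.
have -> : (M + M') * Y = (M + M') / M' * (M' * Y) by field; rewrite gt_eqF.
apply: le_trans (lerD (ler_wpM2l k1 (aM _)) (ler_wpM2l k2 (bM _))).
rewrite !mulr_sumr -big_split; apply: ler_sum => i _ /=.
rewrite big_split_ord /=.
under eq_bigr do rewrite row_mxEl.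
under [X in cabs (_ + X)]eq_bigr do rewrite row_mxEr.
set z := \sum_j _; set w := \sum_j _.
rewrite !sqr_cabs; case: z w => [z1 z2] [w1 w2] /=.
have h (u v : R) : (u + v) ^+ 2 <= (M + M') / M * u ^+ 2 + (M + M') / M' * v ^+ 2.
  have : 0 <= (M' * u - M * v) ^+ 2 / (M * M').
    by rewrite divr_ge0 ?sqr_ge0 // mulr_ge0 // ltW.
  move=> e; rewrite -subr_ge0; apply: (le_trans e); apply: eq_ler; field.
  by rewrite !gt_eqF.
by have := h z1 w1; have := h z2 w2; lra.
Qed.

(** Conjugation by this 0-1 matrix is [mxsub f f], so taking corners and permuting indices become
    instances of the bimodule axiom. *)
Definition selmx m n (f : 'I_m -> 'I_n) : 'M[C]_(m, n) :=
  \matrix_(i, j) (f i == j)%:R.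

Lemma opnorm_selmx m n (f : 'I_m -> 'I_n) : injective f -> opnorm (selmx f) <= 1.
Proof.
move=> fI; apply: sqbounded_opnorm => //; rewrite expr1n.
have idI : injective (id : 'I_n -> 'I_n) by [].
apply: eq_sqbounded; last exact: (sqbounded_sub fI idI (@sqbounded_delta R _)).
by move=> i j; rewrite mxE.
Qed.

Lemma opnorm_selmxT m n (f : 'I_m -> 'I_n) :
  injective f -> opnorm (selmx f)^T <= 1.
Proof.
move=> fI; apply: sqbounded_opnorm => //; rewrite expr1n.
have idI : injective (id : 'I_n -> 'I_n) by [].
apply: eq_sqbounded; last exact: (sqbounded_sub idI fI (@sqbounded_delta R _)).
by move=> i j; rewrite !mxE eq_sym.
Qed.

End OperatorNorm.

(** * Matrices over a vector space *)

Section MatrixIndices.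

Definition mxvec_pair m n (I : 'I_(m * n)) : 'I_m * 'I_n :=
  enum_val (cast_ord (esym (mxvec_cast m n)) I).

Lemma mxvec_indexK m n (i : 'I_m) (j : 'I_n) : mxvec_pair (mxvec_index i j) = (i, j).
Proof. by rewrite /mxvec_pair /mxvec_index cast_ordK enum_rankK. Qed.

Lemma mxvec_pairK m n (I : 'I_(m * n)) :
  mxvec_index (mxvec_pair I).1 (mxvec_pair I).2 = I.
Proof. by case/mxvec_indexP: I => i j; rewrite mxvec_indexK. Qed.

Lemma mxvec_index_eq m n (i i' : 'I_m) (j j' : 'I_n) :
  (mxvec_index i j == mxvec_index i' j') = (i == i') && (j == j').
Proof.
apply/eqP/andP => [|[/eqP-> /eqP-> //]].
by move=> /(congr1 (@mxvec_pair _ _)); rewrite !mxvec_indexK => -[-> ->].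
Qed.

Lemma mxvec_pair_inj m n : injective (@mxvec_pair m n).
Proof. by move=> I J e; rewrite -(mxvec_pairK I) e mxvec_pairK. Qed.

Lemma sum_mxvec_index (V : nmodType) m n (F : 'I_(m * n) -> V) :
  \sum_I F I = \sum_i \sum_j F (mxvec_index i j).
Proof.
rewrite (reindex (fun p : 'I_m * 'I_n => mxvec_index p.1 p.2)) /=.
  exact: sum_pair.
exists (@mxvec_pair m n) => I _; last exact: mxvec_pairK.
by rewrite mxvec_indexK; case: I.
Qed.

Lemma kron4E (V : nmodType) m n p q (F : 'I_m -> 'I_n -> 'I_p -> 'I_q -> V) i k j l :
  kron4 F (mxvec_index i k) (mxvec_index j l) = F i j k l.
Proof.
rewrite mxE (bigD1 i) //= (bigD1 j) //= (bigD1 k) //= (bigD1 l) //= !eqxx /=.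
rewrite big1 => [|l' /negbTE ll]; last first.
  by rewrite mxvec_index_eq [l == _]eq_sym ll !andbF.
rewrite big1 => [|k' /negbTE kk]; last first.
  by rewrite big1 // => l' _; rewrite mxvec_index_eq [k == _]eq_sym kk !andbF.
rewrite big1 => [|j' /negbTE jj]; last first.
  rewrite big1 // => k' _; rewrite big1 // => l' _.
  by rewrite [X in _ && X]mxvec_index_eq [j == _]eq_sym jj !andbF.
rewrite big1 ?addr0 // => i' /negbTE ii.
rewrite big1 // => j' _; rewrite big1 // => k' _; rewrite big1 // => l' _.
by rewrite mxvec_index_eq [i == _]eq_sym ii.
Qed.

End MatrixIndices.

Section Bimodule.
Variables (R : realType) (V : lmodType R[i]).
Local Notation C := R[i].

Lemma lrmxE m n p q (a : 'M[C]_(m, n)) (v : 'M[V]_(n, p)) (b : 'M[C]_(p, q)) i j :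
  lrmx a v b i j = \sum_k \sum_l (a i k * b l j) *: v k l.
Proof.
rewrite !mxE exchange_big; apply: eq_bigr => l _; rewrite mxE scaler_sumr.
by apply: eq_bigr => k _; rewrite scalerA mulrC.
Qed.

Lemma lrmx_comp m n p q r s (a : 'M[C]_(m, n)) (a' : 'M[C]_(n, p))
    (v : 'M[V]_(p, q)) (b' : 'M[C]_(q, r)) (b : 'M[C]_(r, s)) :
  lrmx a (lrmx a' v b') b = lrmx (a *m a') v (b' *m b).
Proof.
apply/matrixP => i j; rewrite !lrmxE.
transitivity (\sum_k \sum_l \sum_k' \sum_l'
    (a i k * a' k k' * (b' l' l * b l j)) *: v k' l').
  apply: eq_bigr => k _; apply: eq_bigr => l _; rewrite lrmxE scaler_sumr.
  apply: eq_bigr => k' _; rewrite scaler_sumr; apply: eq_bigr => l' _.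
  by rewrite scalerA; congr (_ *: _); ring.
rewrite (eq_bigr (fun k => \sum_k' \sum_l \sum_l'
    (a i k * a' k k' * (b' l' l * b l j)) *: v k' l')); last first.
  by move=> k _; rewrite exchange_big.
rewrite exchange_big; apply: eq_bigr => k' _.
rewrite (eq_bigr (fun k => \sum_l' \sum_l
    (a i k * a' k k' * (b' l' l * b l j)) *: v k' l')); last first.
  by move=> k _; rewrite exchange_big.
rewrite exchange_big; apply: eq_bigr => l' _.
rewrite !mxE mulr_suml scaler_suml; apply: eq_bigr => k _.
by rewrite mulr_sumr scaler_suml.
Qed.

Lemma lrmx0 m n p q (a : 'M[C]_(m, n)) (b : 'M[C]_(p, q)) :
  lrmx a (0 : 'M[V]_(n, p)) b = 0.
Proof.
apply/matrixP => i j; rewrite lrmxE mxE big1 // => k _; rewrite big1 // => l _.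
by rewrite mxE scaler0.
Qed.

Lemma lrmxZr m n p q c (a : 'M[C]_(m, n)) (v : 'M[V]_(n, p)) (b : 'M[C]_(p, q)) :
  lrmx a v (c *: b) = lrmx (c *: a) v b.
Proof.
apply/matrixP => i j; rewrite !lrmxE; apply: eq_bigr => k _.
by apply: eq_bigr => l _; rewrite !mxE; congr (_ *: _); ring.
Qed.

Lemma lrmx_map_scale m n p q c (a : 'M[C]_(m, n)) (v : 'M[V]_(n, p))
    (b : 'M[C]_(p, q)) :
  lrmx a (map_mx (fun x => c *: x) v) b = lrmx (c *: a) v b.
Proof.
apply/matrixP => i j; rewrite !lrmxE; apply: eq_bigr => k _; apply: eq_bigr => l _.
by rewrite !mxE scalerA; congr (_ *: _); ring.
Qed.

(** The device by which a sum of two decompositions is again a single decomposition, over the direct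
    sum. *)
Lemma lrmx_row_col m n1 n2 p1 p2 q (a : 'M[C]_(m, n1)) (a' : 'M[C]_(m, n2))
    (v : 'M[V]_(n1, p1)) (w : 'M[V]_(n2, p2))
    (b : 'M[C]_(p1, q)) (b' : 'M[C]_(p2, q)) :
  lrmx (row_mx a a') (block_mx v 0 0 w) (col_mx b b') = lrmx a v b + lrmx a' w b'.
Proof.
apply/matrixP => i j; rewrite [RHS]mxE !lrmxE big_split_ord /=; congr (_ + _).
  apply: eq_bigr => k _; rewrite big_split_ord /= [X in _ + X]big1 ?addr0.
    by apply: eq_bigr => l _; rewrite row_mxEl col_mxEu block_mxEul.
  by move=> l _; rewrite block_mxEur [X in _ *: X]mxE scaler0.
apply: eq_bigr => k _; rewrite big_split_ord /= [X in X + _]big1 ?add0r.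
  by apply: eq_bigr => l _; rewrite row_mxEr col_mxEd block_mxEdr.
by move=> l _; rewrite block_mxEdl [X in _ *: X]mxE scaler0.
Qed.

Lemma lrmx_block m1 m2 n1 n2 p1 p2 q1 q2
    (a : 'M[C]_(m1, n1)) (a' : 'M[C]_(m2, n2))
    (v : 'M[V]_(n1, p1)) (w : 'M[V]_(n2, p2))
    (b : 'M[C]_(p1, q1)) (b' : 'M[C]_(p2, q2)) :
  lrmx (block_mx a 0 0 a') (block_mx v 0 0 w) (block_mx b 0 0 b') =
  block_mx (lrmx a v b) 0 0 (lrmx a' w b').
Proof.
rewrite [block_mx a 0 0 a']block_mxEh [block_mx b 0 0 b']block_mxEv lrmx_row_col.
apply/matrixP => i j; rewrite [LHS]mxE !lrmxE.
case: (split_ordP i) => i' ->; case: (split_ordP j) => j' ->;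
  rewrite ?(block_mxEul, block_mxEur, block_mxEdl, block_mxEdr) ?lrmxE.
- rewrite [X in _ + X]big1 ?addr0.
    by apply: eq_bigr => k _; apply: eq_bigr => l _; rewrite col_mxEu row_mxEl.
  by move=> k _; rewrite big1 // => l _; rewrite col_mxEu [X in X * _]mxE mul0r scale0r.
- rewrite mxE !big1 ?addr0 // => k _; rewrite big1 // => l _.
    by rewrite col_mxEu [X in X * _]mxE mul0r scale0r.
  by rewrite row_mxEr [X in _ * X]mxE mulr0 scale0r.
- rewrite mxE !big1 ?addr0 // => k _; rewrite big1 // => l _.
    by rewrite row_mxEl [X in _ * X]mxE mulr0 scale0r.
  by rewrite col_mxEd [X in X * _]mxE mul0r scale0r.
- rewrite [X in X + _]big1 ?add0r.
    by apply: eq_bigr => k _; apply: eq_bigr => l _; rewrite col_mxEd row_mxEr.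
  by move=> k _; rewrite big1 // => l _; rewrite col_mxEd [X in X * _]mxE mul0r scale0r.
Qed.

Lemma lrmx_sel m n (f : 'I_m -> 'I_n) (v : 'M[V]_n) :
  lrmx (selmx R f) v (selmx R f)^T = mxsub f f v.
Proof.
apply/matrixP => i j; rewrite lrmxE mxE (bigD1 (f i)) //= (bigD1 (f j)) //=.
rewrite !mxE !eqxx mulr1 scale1r big1 => [|l /negbTE ll].
  rewrite big1 ?addr0 // => k /negbTE kk; rewrite big1 // => l _.
  by rewrite !mxE eq_sym kk mul0r scale0r.
by rewrite !mxE [_ == l]eq_sym ll mulr0 scale0r.
Qed.

Lemma sum_lrmx_delta n (u : 'M[V]_n) :
  u = \sum_i \sum_j lrmx (delta_mx i 0) (const_mx (u i j) : 'M_1) (delta_mx 0 j).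
Proof.
apply/matrixP => i j; rewrite summxE (bigD1 i) //= summxE (bigD1 j) //=.
rewrite lrmxE !big_ord1 !mxE !eqxx mulr1 scale1r big1 => [|l /negbTE ll].
  rewrite big1 ?addr0 // => k /negbTE kk; rewrite summxE big1 // => l _.
  by rewrite lrmxE !big_ord1 !mxE [i == _]eq_sym kk mul0r scale0r.
by rewrite lrmxE !big_ord1 !mxE [j == _]eq_sym ll andbF mulr0 scale0r.
Qed.

Lemma linear_fun_sum (W : lmodType C) (T : V -> W) (I : finType) (F : I -> V) :
  linear T -> T (\sum_i F i) = \sum_i T (F i).
Proof.
move=> TL; have TD x y : T (x + y) = T x + T y.
  by have := TL 1 x y; rewrite !scale1r.
have T0 : T 0 = 0 by apply: (addrI (T 0)); rewrite -TD !addr0.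
exact: (big_morph T).
Qed.

End Bimodule.

Lemma map_lrmx (R : realType) (V W : lmodType R[i]) (T : V -> W) m n p q
    (a : 'M[R[i]]_(m, n)) (v : 'M[V]_(n, p)) (b : 'M[R[i]]_(p, q)) :
  linear T -> map_mx T (lrmx a v b) = lrmx a (map_mx T v) b.
Proof.
move=> TL; apply/matrixP => i j; rewrite [LHS]mxE !lrmxE linear_fun_sum //.
apply: eq_bigr => k _; rewrite linear_fun_sum //; apply: eq_bigr => l _.
by rewrite (scalable_linear TL) [X in _ = _ *: X]mxE.
Qed.

(** * Consequences of Ruan's axioms *)

Section OperatorSpace.
Variables (R : realType) (V : lmodType R[i]) (N : @mnorms R V).
Hypothesis NO : opspace N.
Local Notation C := R[i].

Lemma opspace_eq0 n (v : 'M[V]_n) : N v = 0 -> v = 0.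
Proof. by case: NO => /(_ n v v)[]. Qed.

Lemma opspaceZ n (c : C) (v : 'M[V]_n) :
  N (map_mx (fun x => c *: x) v) = cabs c * N v.
Proof. by case: NO => /(_ n v v)[]. Qed.

Lemma opspaceD n (v w : 'M[V]_n) : N (v + w) <= N v + N w.
Proof. by case: NO => /(_ n v w)[]. Qed.

Lemma opspace_lrmx m n (a : 'M[C]_(m, n)) (v : 'M[V]_n) (b : 'M[C]_(n, m)) :
  N (lrmx a v b) <= opnorm a * N v * opnorm b.
Proof. by case: NO => _ + _; apply. Qed.

Lemma opspace_block n m (v : 'M[V]_n) (w : 'M[V]_m) :
  N (block_mx v 0 0 w) = Num.max (N v) (N w).
Proof. by case: NO => _ _; apply. Qed.

Lemma opspace0 n : N (0 : 'M[V]_n) = 0.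
Proof.
have := opspaceZ 0 (0 : 'M[V]_n); rewrite cabs0 mul0r => e; rewrite -[RHS]e.
by congr (N _); apply/matrixP => i j; rewrite !mxE scaler0.
Qed.

Lemma opspaceN n (v : 'M[V]_n) : N (- v) = N v.
Proof.
have := opspaceZ (-1) v; rewrite cabsN cabs1 mul1r => <-; congr (N _).
by apply/matrixP => i j; rewrite !mxE scaleN1r.
Qed.

Lemma opspace_ge0 n (v : 'M[V]_n) : 0 <= N v.
Proof.
by have := opspaceD v (- v); rewrite subrr opspace0 opspaceN; lra.
Qed.

Lemma opspace_mxsub m n (f : 'I_m -> 'I_n) (v : 'M[V]_n) :
  injective f -> N (mxsub f f v) <= N v.
Proof.
move=> fI; rewrite -(lrmx_sel (R := R)); apply: (le_trans (opspace_lrmx _ _ _)).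
have := opnorm_selmx R fI; have := opnorm_selmxT R fI.
have := opnorm_ge0 (selmx R f); have := opnorm_ge0 (selmx R f)^T.
have := opspace_ge0 v; set x := N v; set a := opnorm _; set b := opnorm _.
move=> x0 a0 b0 a1 b1; apply: le_trans (_ : 1 * x * 1 <= _); last by lra.
by apply: ler_pM => //; [rewrite mulr_ge0|apply: ler_wpM2r].
Qed.

(** Induction on [q]: up to a permutation of indices, [x (x) 1] of size [q.+1] is the direct sum of
    [x] and [x (x) 1] of size [q]. *)
Lemma opspace_amplify p q (x : 'M[V]_p) :
  N (kron4 (fun i j (k l : 'I_q) => if k == l then x i j else 0)) <= N x.
Proof.
elim: q => [|q IH].
  rewrite [kron4 _](_ : _ = 0) ?opspace0 ?opspace_ge0 //.
  by apply/matrixP => I; case/mxvec_indexP: I => i [].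
(* The index [(i, 0)] goes to the block of [x], and [(i, k + 1)] to the place [(i, k)] of the
   smaller amplification. *)
pose f (I : 'I_(p * q.+1)) : 'I_(p + p * q) :=
  if unlift ord0 (mxvec_pair I).2 is Some k then rshift p (mxvec_index (mxvec_pair I).1 k)
  else lshift (p * q) (mxvec_pair I).1.
have f0 i : f (mxvec_index i ord0) = lshift _ i.
  by rewrite /f mxvec_indexK /= unlift_none.
have fS i k : f (mxvec_index i (lift ord0 k)) = rshift _ (mxvec_index i k).
  by rewrite /f mxvec_indexK /= liftK.
have fI : injective f.
  move=> I J; case/mxvec_indexP: I => i k; case/mxvec_indexP: J => j l.
  case: (unliftP ord0 k) => [k'|] ->; case: (unliftP ord0 l) => [l'|] ->;
    rewrite ?(f0, fS) => /eqP.
  - by rewrite eq_rshift mxvec_index_eq => /andP[/eqP-> /eqP->].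
  - by rewrite eq_rlshift.
  - by rewrite eq_lrshift.
  - by rewrite eq_lshift => /eqP ->.
set y := kron4 _ in IH.
apply: (@le_trans _ _ (N (block_mx x 0 0 y))); last first.
  by rewrite opspace_block ge_max lexx.
apply: le_trans (opspace_mxsub _ fI); apply: eq_ler; congr (N _).
apply/matrixP => I J; rewrite [RHS]mxE.
case/mxvec_indexP: I => i k; case/mxvec_indexP: J => j l; rewrite kron4E.
case: (unliftP ord0 k) => [k'|] ->; case: (unliftP ord0 l) => [l'|] ->; rewrite ?(f0, fS).
- by rewrite block_mxEdr kron4E (inj_eq lift_inj).
- by rewrite block_mxEdl mxE.
- by rewrite block_mxEur mxE.
- by rewrite block_mxEul eqxx.
Qed.

Lemma opspace_amplifyl p q (x : 'M[V]_q) :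
  N (kron4 (fun (i j : 'I_p) k l => if i == j then x k l else 0)) <= N x.
Proof.
apply: le_trans (opspace_amplify p x).
pose f (I : 'I_(p * q)) := mxvec_index (mxvec_pair I).2 (mxvec_pair I).1.
have fI : injective f.
  move=> I J; case/mxvec_indexP: I => i k; case/mxvec_indexP: J => j l.
  by rewrite /f !mxvec_indexK /= => /eqP; rewrite mxvec_index_eq => /andP[/eqP-> /eqP->].
apply: le_trans (opspace_mxsub _ fI); apply: eq_ler; congr (N _).
apply/matrixP => I J; rewrite [RHS]mxE.
case/mxvec_indexP: I => i k; case/mxvec_indexP: J => j l.
by rewrite kron4E /f !mxvec_indexK kron4E.
Qed.

(* For [w := f(v) xi] one has [|w|^2 = f (w^* v xi) <= |w| |v| |xi|]. *)
Lemma functional_cbounded (f : V -> C) n (v : 'M[V]_n) :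
  islin f -> (forall x, cabs (f x) <= N (const_mx x : 'M_1)) ->
  opnorm (map_mx f v) <= N v.
Proof.
move=> fL fN; apply: sqbounded_opnorm; first exact: opspace_ge0.
have fL' : linear (f : V -> C^o) by move=> c x y; exact: fL.
move=> x; pose w := map_mx f v *m (\col_j x j).
have wE i : w i 0 = \sum_j map_mx f v i j * x j.
  by rewrite mxE; apply: eq_bigr => j _; rewrite [X in _ * X]mxE.
under eq_bigr do rewrite -wE.
rewrite -sqr_l2norm.
have -> : \sum_j cabs (x j) ^+ 2 = l2norm (\col_j x j) ^+ 2.
  by rewrite sqr_l2norm; apply: eq_bigr => j _; rewrite mxE.
set xi := \col_j x j; pose eta := (map_mx (@conjc R) w)^T.
have etaE i k : eta i k = (w k 0)^*%C by rewrite mxE mxE ord1.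
have eq1 : map_mx f (lrmx eta v xi) = (l2norm w ^+ 2)%:C%C%:M.
  rewrite (map_lrmx (W := C^o) _ _ _ fL').
  apply/matrixP => i j; rewrite !ord1 lrmxE [RHS]mxE mulr1n sqr_l2norm rmorph_sum /=.
  apply: eq_bigr => k _; rewrite -mulcconj [X in _ = _ * X]wE mulr_sumr.
  apply: eq_bigr => l _; rewrite etaE [xi _ _]mxE mulrA; exact: mulrAC.
have : cabs (l2norm w ^+ 2)%:C%C <= l2norm w * N v * l2norm xi.
  have -> : (l2norm w ^+ 2)%:C%C = f (lrmx eta v xi 0 0).
    by have /matrixP/(_ 0 0) := eq1; rewrite !mxE mulr1n.
  apply: (le_trans (fN _)).
  have -> : const_mx (lrmx eta v xi 0 0) = lrmx eta v xi.
    by apply/matrixP => i j; rewrite !ord1 mxE.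
  apply: (le_trans (opspace_lrmx _ _ _)).
  apply: ler_pM; rewrite ?opnorm_ge0 ?mulr_ge0 ?opspace_ge0 ?opnorm_ge0 ?opnorm_col_le //.
  apply: ler_wpM2r; first exact: opspace_ge0.
  apply: (le_trans (opnorm_row_le _)); rewrite trmxK /l2norm.
  by apply: eq_ler; congr Num.sqrt; apply: eq_bigr => i _; rewrite mxE cabs_conj.
rewrite cabs_real ger0_norm ?sqr_ge0 // -exprMn.
have := l2norm_ge0 w; have := opspace_ge0 v; have := l2norm_ge0 xi.
set a := l2norm w; set b := N v; set c := l2norm xi => c0 b0 a0 h.
rewrite ler_sqr ?nnegrE ?mulr_ge0 //.
have [->|an] := eqVneq a 0; first by rewrite mulr_ge0.
have ap : 0 < a by rewrite lt0r an.
by rewrite -(ler_pM2l ap) -expr2 mulrA.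
Qed.

(** Scaling [v] to norm one puts it in the set whose supremum is [cbnorm]; [cbounded] makes that
    supremum genuine. Of [NW] only sub-homogeneity is asked, so the lemma serves [Mp_norms] as well
    as operator spaces. *)
Lemma cbnorm_le (W : lmodType C) (NW : @mnorms R W) (T : V -> W) n (v : 'M[V]_n) :
  (forall n (c : C) (w : 'M[W]_n), NW n (map_mx (fun x => c *: x) w) <= cabs c * NW n w) ->
  linear T -> cbounded N NW T -> NW n (map_mx T v) <= cbnorm N NW T * N v.
Proof.
move=> NWZ TL [M TM].
have TZ (c : C) (w : 'M[V]_n) :
    map_mx T (map_mx (fun x => c *: x) w) = map_mx (fun x => c *: x) (map_mx T w).
  apply/matrixP => i j; rewrite !mxE; exact: scalable_linear.
have T0 : NW n (map_mx T 0) <= 0.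
  have -> : map_mx T (0 : 'M[V]_n) = map_mx (fun x : W => (0 : C) *: x) (map_mx T 0).
    by rewrite -TZ; congr map_mx; apply/matrixP => i j; rewrite !mxE scaler0.
  by apply: (le_trans (NWZ _ _ _)); rewrite cabs0 mul0r.
have [v0|vn0] := eqVneq (N v) 0.
  by rewrite v0 mulr0 (opspace_eq0 v0).
have vp : 0 < N v by rewrite lt0r vn0 opspace_ge0.
pose w := map_mx (fun x => (N v)^-1%:C%C *: x) v.
have vw : v = map_mx (fun x => (N v)%:C%C *: x) w.
  by apply/matrixP => i j; rewrite !mxE scalerA -rmorphM mulfV //= scale1r.
rewrite {1}vw TZ; apply: (le_trans (NWZ _ _ _)).
rewrite cabs_real gtr0_norm // mulrC; apply: ler_wpM2r; first exact: ltW.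
have Nw : N w = 1.
  by rewrite opspaceZ cabs_real gtr0_norm ?invr_gt0 // mulVf.
apply: ub_le_sup; last by exists n, w; split; rewrite ?Nw.
exists `|M| => _ [k [u [_ u1 ->]]].
apply: (le_trans (TM _ _ _)) => //.
apply: (@le_trans _ _ (`|M| * N u)).
  by apply: ler_wpM2r; rewrite ?opspace_ge0 ?ler_norm.
by rewrite ler_piMr.
Qed.

Lemma cbnorm_ge0 (W : lmodType C) (NW : @mnorms R W) (T : V -> W) :
  (forall n (w : 'M[W]_n), 0 <= NW n w) -> cbounded N NW T -> 0 <= cbnorm N NW T.
Proof.
move=> NW0 [M TM].
apply: (le_trans (NW0 0 (map_mx T 0))); apply: ub_le_sup.
  exists `|M| => _ [k [u [_ u1 ->]]].
  apply: (le_trans (TM _ _ _)) => //; apply: (@le_trans _ _ (`|M| * N u)).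
    by apply: ler_wpM2r; rewrite ?opspace_ge0 ?ler_norm.
  by rewrite ler_piMr.
by exists 0, 0; split; rewrite ?opspace0.
Qed.

End OperatorSpace.

(** * The algebraic tensor product *)

Section Functionals.
Variables (R : realType) (V : lmodType R[i]) (f : V -> R[i]).
Hypothesis fL : islin f.

Lemma islin0 : f 0 = 0.
Proof.
by have := fL (-1) 0 0; rewrite scaler0 addr0 mulN1r addNr.
Qed.

Lemma islinZ c x : f (c *: x) = c * f x.
Proof. by have := fL c x 0; rewrite islin0 !addr0. Qed.

End Functionals.

Lemma sum_delta (R : realType) (V : lmodType R[i]) (I : finType) (i : I) (G : I -> V) :
  \sum_j (i == j)%:R *: G j = G i.
Proof.
rewrite (bigD1 i) //= eqxx scale1r big1 ?addr0 // => j.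
by rewrite eq_sym => /negbTE ->; rewrite scale0r.
Qed.

Lemma lrmx_scalar (R : realType) (V : lmodType R[i]) k c (u : 'M[V]_k) :
  lrmx (c *: 1%:M) u 1%:M = map_mx (fun x => c *: x) u.
Proof.
apply/matrixP => i j; rewrite lrmxE mxE -[in RHS](sum_delta i (fun k => u k j)).
rewrite scaler_sumr; apply: eq_bigr => l _.
rewrite -[in RHS](sum_delta j (u l)) !scaler_sumr; apply: eq_bigr => m _.
by rewrite !mxE !scalerA [m == j]eq_sym mulrA.
Qed.

Section Tensors.
Variables (R : realType) (E F : lmodType R[i]).
Local Notation C := R[i].
Implicit Types (x : E) (y : F).

Lemma tens_elE x y f g : islin f -> islin g -> tens_el x y f g = f x * g y.
Proof. by move=> fL gL; rewrite /tens_el asboolT. Qed.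

Lemma tensD (s t : tens E F) f g : (s + t) f g = s f g + t f g.
Proof. by []. Qed.

Lemma tensZ c (t : tens E F) f g : (c *: t) f g = c * t f g.
Proof. by []. Qed.

Lemma tens_sum (I : finType) (t : I -> tens E F) f g :
  (\sum_i t i) f g = \sum_i t i f g.
Proof. by rewrite !fct_sumE. Qed.

(** Elements of [tens] are also defined on non-linear pairs, where equality has to be checked
    separately; [tens_el] and [tensmap] take the default value 0 there. *)
Lemma tens_ext (s t : tens E F) :
  (forall f g, islin f -> islin g -> s f g = t f g) ->
  (forall f g, ~ (islin f /\ islin g) -> s f g = t f g) -> s = t.
Proof.
move=> H1 H2; apply: funext => f; apply: funext => g.
by have [[fL gL]|n] := pselect (islin f /\ islin g); [apply: H1|apply: H2].
Qed.

Lemma tens_el_nonlin x y f g : ~ (islin f /\ islin g) -> tens_el x y f g = 0.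
Proof. by move=> n; rewrite /tens_el asboolF. Qed.

Lemma tens_elZl c x y : tens_el (c *: x) y = c *: tens_el x y.
Proof.
apply: tens_ext => [f g fL gL|f g n]; rewrite tensZ.
  by rewrite !tens_elE // islinZ // mulrA.
by rewrite !tens_el_nonlin // mulr0.
Qed.

Lemma tens_elZr c x y : tens_el x (c *: y) = c *: tens_el x y.
Proof.
apply: tens_ext => [f g fL gL|f g n]; rewrite tensZ.
  by rewrite !tens_elE // islinZ // mulrCA.
by rewrite !tens_el_nonlin // mulr0.
Qed.

Lemma tens_el0l y : tens_el (0 : E) y = 0.
Proof. by rewrite -(scale0r 0) tens_elZl scale0r. Qed.

Lemma tens_el0r x : tens_el x (0 : F) = 0.
Proof. by rewrite -(scale0r 0) tens_elZr scale0r. Qed.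

Lemma intens_ind (P : tens E F -> Prop) :
  P 0 -> (forall x y, P (tens_el x y)) ->
  (forall (c : C) u v, P u -> P v -> P (c *: u + v)) ->
  forall t, intens t -> P t.
Proof. by move=> P0 Pel Plin t /asboolP; apply. Qed.

(** All matrices over [E (x) F] arise from elementary tensors of size one by sums and the bimodule
    action. The principle yields the existence of both kinds of decomposition. *)
Lemma mx_intens_ind (P : forall k, 'M[tens E F]_k -> Prop) :
  (forall k (u w : 'M[tens E F]_k), P k u -> P k w -> P k (u + w)) ->
  (forall k n (a : 'M[C]_(k, n)) (u : 'M[tens E F]_n) (b : 'M[C]_(n, k)),
    P n u -> P k (lrmx a u b)) ->
  (forall x y, P 1%N (const_mx (tens_el x y))) ->
  forall k (u : 'M[tens E F]_k), (forall i j, intens (u i j)) -> P k u.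
Proof.
move=> PD Plr Pel k u uI; rewrite (sum_lrmx_delta u).
have P0 n : P n 0.
  have := Plr n 1%N 0 _ 0 (Pel 0 0); rewrite tens_el0l.
  by rewrite -[const_mx 0]/(0 : 'M_1) lrmx0.
have Ps (I : finType) (w : I -> 'M[tens E F]_k) :
    (forall i, P k (w i)) -> P k (\sum_i w i).
  by move=> H; apply: big_ind => //; exact: PD.
apply: (Ps) => i; apply: Ps => j; apply: (Plr).
elim/intens_ind: (u i j) / (uI i j) => [|x y|c s t hs ht] //.
have -> : const_mx (c *: s + t) =
   lrmx (c *: 1%:M) (const_mx s : 'M_1) 1%:M + const_mx t :> 'M[tens E F]_1.
  by rewrite lrmx_scalar; apply/matrixP => i' j'; rewrite !mxE.
by apply: PD => //; apply: Plr.
Qed.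

Variable theta : R.

Lemma odot_delta n (p q r s i j : 'I_n) :
  odot theta (delta_mx p q) (delta_mx r s) i j =
  (1 - theta)%:C%C * ((i == p)%:R * ((q == r)%:R * (j == s)%:R)) +
  theta%:C%C * ((i == r)%:R * ((s == p)%:R * (j == q)%:R)).
Proof.
rewrite /odot !mul_delta_mx_cond !mxE; congr (_ * _ + _ * _).
  by rewrite mulmxnE mxE; case: (q == r); case: (i == p); case: (j == s);
     rewrite ?(mulr0, mul0r, mulr1).
by rewrite mulmxnE mxE; case: (s == p); case: (i == r); case: (j == q);
   rewrite ?(mulr0, mul0r, mulr1).
Qed.

Lemma otimes_odotE n (v1 : 'M[E]_n) (v2 : 'M[F]_n) i j :
  otimes_odot theta v1 v2 i j =
  (1 - theta)%:C%C *: (\sum_k tens_el (v1 i k) (v2 k j)) +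
  theta%:C%C *: (\sum_k tens_el (v1 k j) (v2 i k)).
Proof.
pose t p q r s : tens E F := tens_el (v1 p q) (v2 r s).
transitivity (\sum_p \sum_q \sum_r \sum_s
   (((1 - theta)%:C%C *: ((i == p)%:R *: ((q == r)%:R *: ((j == s)%:R *: t p q r s))))
   + theta%:C%C *: ((i == r)%:R *: ((s == p)%:R *: ((j == q)%:R *: t p q r s))))).
  rewrite summxE; apply: eq_bigr => p _; rewrite summxE; apply: eq_bigr => q _.
  rewrite summxE; apply: eq_bigr => r _; rewrite summxE; apply: eq_bigr => s _.
  by rewrite mxE odot_delta scalerDl -!scalerA.
transitivity (
   (1 - theta)%:C%C *: (\sum_p (i == p)%:R *: \sum_q \sum_r (q == r)%:R *:
     \sum_s (j == s)%:R *: t p q r s) +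
   theta%:C%C *: (\sum_p \sum_q (j == q)%:R *: \sum_r (i == r)%:R *:
     \sum_s (p == s)%:R *: t p q r s)).
  rewrite !scaler_sumr -big_split; apply: eq_bigr => p _ /=.
  rewrite !scaler_sumr -big_split; apply: eq_bigr => q _ /=.
  rewrite !scaler_sumr -big_split; apply: eq_bigr => r _ /=.
  rewrite !scaler_sumr -big_split; apply: eq_bigr => s _ /=.
  rewrite [s == p]eq_sym !scalerA; congr (_ *: _ + _ *: _); ring.
congr (_ *: _ + _ *: _).
  rewrite sum_delta; apply: eq_bigr => q _; rewrite sum_delta sum_delta //.
by apply: eq_bigr => p _; rewrite sum_delta sum_delta sum_delta.
Qed.

Lemma otimes_odotZ n c d (v1 : 'M[E]_n) (v2 : 'M[F]_n) :
  otimes_odot theta (map_mx (fun x => c *: x) v1) (map_mx (fun y => d *: y) v2) =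
  map_mx (fun t => (c * d) *: t) (otimes_odot theta v1 v2).
Proof.
apply/matrixP => i j; rewrite [RHS]mxE !otimes_odotE scalerDr !scalerA.
rewrite ![_ * _ * _%:C%C]mulrC -!scalerA !scaler_sumr.
by congr (_ + _); apply: eq_bigr => k _;
  rewrite !mxE tens_elZl tens_elZr !scalerA.
Qed.

Lemma otimes_odot0l n (v2 : 'M[F]_n) : otimes_odot theta (0 : 'M[E]_n) v2 = 0.
Proof.
apply/matrixP => i j; rewrite otimes_odotE !big1 ?scaler0 ?addr0 ?mxE // => k _;
  by rewrite mxE tens_el0l.
Qed.

Lemma otimes_odot0r n (v1 : 'M[E]_n) : otimes_odot theta v1 (0 : 'M[F]_n) = 0.
Proof.
apply/matrixP => i j; rewrite otimes_odotE !big1 ?scaler0 ?addr0 ?mxE // => k _;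
  by rewrite mxE tens_el0r.
Qed.

Lemma otimes_odot_block n m (v1 : 'M[E]_n) (v2 : 'M[F]_n) (w1 : 'M[E]_m) (w2 : 'M[F]_m) :
  otimes_odot theta (block_mx v1 0 0 w1) (block_mx v2 0 0 w2) =
  block_mx (otimes_odot theta v1 v2) 0 0 (otimes_odot theta w1 w2).
Proof.
apply/matrixP => i j; rewrite otimes_odotE !big_split_ord /=.
case: (split_ordP i) => i' ->; case: (split_ordP j) => j' ->;
  rewrite ?(block_mxEul, block_mxEur, block_mxEdl, block_mxEdr) ?otimes_odotE;
  under eq_bigr do rewrite ?(block_mxEul, block_mxEur, block_mxEdl, block_mxEdr);
  under [X in _ *: (_ + X) + _]eq_bigr
    do rewrite ?(block_mxEul, block_mxEur, block_mxEdl, block_mxEdr);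
  under [X in _ + _ *: (X + _)]eq_bigr
    do rewrite ?(block_mxEul, block_mxEur, block_mxEdl, block_mxEdr);
  under [X in _ + _ *: (_ + X)]eq_bigr
    do rewrite ?(block_mxEul, block_mxEur, block_mxEdl, block_mxEdr).
- rewrite [X in _ *: (_ + X) + _]big1 ?[X in _ + _ *: (_ + X)]big1 ?addr0 // => k _;
  by rewrite !mxE ?tens_el0l ?tens_el0r.
- by rewrite !big1 ?addr0 ?scaler0 ?addr0 ?mxE // => k _; rewrite !mxE ?tens_el0l ?tens_el0r.
- by rewrite !big1 ?addr0 ?scaler0 ?addr0 ?mxE // => k _; rewrite !mxE ?tens_el0l ?tens_el0r.
- rewrite [X in _ *: (X + _) + _]big1 ?[X in _ + _ *: (X + _)]big1 ?add0r // => k _;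
  by rewrite !mxE ?tens_el0l ?tens_el0r.
Qed.

(** Nonemptiness of the set whose infimum is [odot_norm]. *)
Definition odot_repr k (u : 'M[tens E F]_k) : Prop :=
  exists j (a : 'M[C]_(k, j)) (v1 : 'M[E]_j) (v2 : 'M[F]_j) (b : 'M[C]_(j, k)),
    u = lrmx a (otimes_odot theta v1 v2) b.

Lemma odot_reprD k (u w : 'M[tens E F]_k) :
  odot_repr u -> odot_repr w -> odot_repr (u + w).
Proof.
move=> [j [a [v1 [v2 [b ->]]]]] [j' [a' [v1' [v2' [b' ->]]]]].
exists (j + j')%N, (row_mx a a'), (block_mx v1 0 0 v1'), (block_mx v2 0 0 v2').
by exists (col_mx b b'); rewrite otimes_odot_block lrmx_row_col.
Qed.

Lemma odot_repr_lrmx k n (a : 'M[C]_(k, n)) (u : 'M[tens E F]_n) (b : 'M[C]_(n, k)) :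
  odot_repr u -> odot_repr (lrmx a u b).
Proof.
move=> [j [a' [v1 [v2 [b' ->]]]]]; rewrite lrmx_comp.
by exists j, (a *m a'), v1, v2, (b' *m b).
Qed.

Lemma odot_repr_intens k (u : 'M[tens E F]_k) :
  (forall i j, intens (u i j)) -> odot_repr u.
Proof.
apply: (mx_intens_ind (P := odot_repr)).
- exact: odot_reprD.
- exact: odot_repr_lrmx.
(* In size one both products are [x (x) y], and the weights [1 - theta] and [theta] add up to 1. *)
- move=> x y; exists 1, (1 *: 1%:M), (const_mx x), (const_mx y), 1%:M.
  rewrite lrmx_scalar; apply/matrixP => i j.
  rewrite !ord1 !mxE scale1r otimes_odotE !big_ord1 !mxE.
  by rewrite -scalerDl -rmorphD /= subrK scale1r.
Qed.

End Tensors.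

(** * The norms of [odot] *)

Section OdotNorm.
Variables (R : realType) (theta : R) (E F : lmodType R[i]).
Variables (NE : @mnorms R E) (NF : @mnorms R F).
Hypotheses (EO : opspace NE) (FO : opspace NF).
Local Notation C := R[i].
Local Notation odotN := (odot_norm theta NE NF).

Lemma odot_norm_le k j (a : 'M[C]_(k, j)) (v1 : 'M[E]_j) (v2 : 'M[F]_j) (b : 'M[C]_(j, k)) :
  odotN (lrmx a (otimes_odot theta v1 v2) b) <= opnorm a * NE v1 * NF v2 * opnorm b.
Proof.
apply: ge_inf; last by exists j, a, v1, v2, b.
exists 0 => _ [j' [a' [w1 [w2 [b' [_ ->]]]]]].
by rewrite !mulr_ge0 ?opnorm_ge0 // opspace_ge0.
Qed.

(* The factor [c] may vanish, in which case representability provides a witness. *)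
Lemma le_odot_norm k (u : 'M[tens E F]_k) (m c : R) : 0 <= c -> odot_repr theta u ->
  (forall j (a : 'M[C]_(k, j)) (v1 : 'M[E]_j) (v2 : 'M[F]_j) (b : 'M[C]_(j, k)),
    u = lrmx a (otimes_odot theta v1 v2) b ->
    m <= c * (opnorm a * NE v1 * NF v2 * opnorm b)) ->
  m <= c * odotN u.
Proof.
move=> c0 [j [a [v1 [v2 [b uE]]]]] H.
move: c0; rewrite le_eqVlt => /predU1P[c0|cp].
  by have := H _ _ _ _ _ uE; rewrite -c0 !mul0r.
rewrite -ler_pdivrMl //; apply: lb_le_inf.
  by exists (opnorm a * NE v1 * NF v2 * opnorm b), j, a, v1, v2, b.
move=> _ [j' [a' [w1 [w2 [b' [uE' ->]]]]]].
by rewrite ler_pdivrMl //; apply: H.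
Qed.

Lemma odot_norm_ge0 k (u : 'M[tens E F]_k) : odot_repr theta u -> 0 <= odotN u.
Proof.
move=> ur; rewrite -[odotN u]mul1r; apply: le_odot_norm => // j a v1 v2 b _.
by rewrite mul1r !mulr_ge0 ?opnorm_ge0 // opspace_ge0.
Qed.

Lemma odot_norm_lrmx k n (a : 'M[C]_(k, n)) (u : 'M[tens E F]_n) (b : 'M[C]_(n, k)) :
  odot_repr theta u -> odotN (lrmx a u b) <= opnorm a * odotN u * opnorm b.
Proof.
move=> ur; rewrite mulrAC.
apply: le_odot_norm => // [|j a' v1 v2 b' ->]; first by rewrite mulr_ge0 ?opnorm_ge0.
rewrite lrmx_comp; apply: (le_trans (odot_norm_le _ _ _ _)).
have -> : opnorm a * opnorm b * (opnorm a' * NE v1 * NF v2 * opnorm b') =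
  opnorm a * opnorm a' * NE v1 * NF v2 * (opnorm b' * opnorm b) by ring.
have v10 := opspace_ge0 EO v1; have v20 := opspace_ge0 FO v2.
apply: ler_pM; rewrite ?opnorm_mul ?opnorm_ge0 //.
  by rewrite !mulr_ge0 ?opnorm_ge0.
by do 2![apply: ler_wpM2r => //]; apply: opnorm_mul.
Qed.

Lemma odot_normZ_le k (u : 'M[tens E F]_k) c : odot_repr theta u ->
  odotN (map_mx (fun x => c *: x) u) <= cabs c * odotN u.
Proof.
move=> ur; rewrite -lrmx_scalar; apply: (le_trans (odot_norm_lrmx _ _ ur)).
have u0 := odot_norm_ge0 ur.
rewrite -[X in _ <= X]mulr1; apply: ler_pM; rewrite ?opnorm_ge0 ?opnorm1 //.
  by rewrite mulr_ge0 ?opnorm_ge0.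
apply: ler_wpM2r => //; apply: (le_trans (opnormZ _ _)).
by rewrite ler_piMr ?cabs_ge0 ?opnorm1.
Qed.

(** The reverse inequality is [odot_normZ_le] for the scalar [c^-1], once [c = 0] is set aside. *)
Lemma odot_normZ k (u : 'M[tens E F]_k) c : odot_repr theta u ->
  odotN (map_mx (fun x => c *: x) u) = cabs c * odotN u.
Proof.
move=> ur; apply/eqP; rewrite eq_le odot_normZ_le //=.
have cur : odot_repr theta (map_mx (fun x => c *: x) u).
  by rewrite -lrmx_scalar; apply: odot_repr_lrmx.
have [c0|c0] := eqVneq c 0.
  by rewrite [in X in X * _]c0 cabs0 mul0r odot_norm_ge0.
have cp : 0 < cabs c.
  by rewrite lt0r cabs_ge0 andbT; apply: contra c0 => /eqP/cabs_eq0 ->.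
rewrite -ler_pdivlMl // -cabsV; apply: le_trans (odot_normZ_le _ cur).
apply: eq_ler; congr odot_norm; apply/matrixP => i j.
by rewrite !mxE scalerA mulVf // scale1r.
Qed.

Definition odot_dec k (u : 'M[tens E F]_k) (r : R) : Prop :=
  exists j (a : 'M[C]_(k, j)) (v1 : 'M[E]_j) (v2 : 'M[F]_j) (b : 'M[C]_(j, k)),
    [/\ u = lrmx a (otimes_odot theta v1 v2) b, NE v1 <= 1, NF v2 <= 1,
        opnorm a ^+ 2 <= r & opnorm b ^+ 2 <= r].

Lemma odot_dec_le k (u : 'M[tens E F]_k) r : odot_dec u r -> odotN u <= r.
Proof.
move=> [j [a [v1 [v2 [b [-> h1 h2 ha hb]]]]]].
apply: (le_trans (odot_norm_le _ _ _ _)).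
have v10 := opspace_ge0 EO v1; have v20 := opspace_ge0 FO v2.
have a0 := opnorm_ge0 a; have b0 := opnorm_ge0 b.
apply: (@le_trans _ _ (opnorm a * opnorm b)).
  apply: ler_wpM2r => //; rewrite -mulrA ler_piMr //.
  by rewrite mulr_ile1.
have : 0 <= (opnorm a - opnorm b) ^+ 2 by apply: sqr_ge0.
by rewrite sqrrB; nra.
Qed.

Lemma odot_dec0 k r : 0 <= r -> odot_dec (0 : 'M[tens E F]_k) r.
Proof.
(* Zero factors through matrices of inner size [j = 0]. *)
move=> r0; exists 0, 0, 0, 0, 0; split; rewrite ?opspace0 //.
- by apply/matrixP => i j; rewrite lrmxE big_ord0 mxE.
- apply: sqbounded_sqr_opnorm => // x.
  by rewrite big1 ?mulr_ge0 ?sumsq_ge0 // => i _; rewrite big_ord0 cabs0 expr0n.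
- apply: sqbounded_sqr_opnorm => // x.
  by rewrite big_ord0 ?mulr_ge0 ?sumsq_ge0.
Qed.

(* Rescaling so that [v1] and [v2] become unit vectors and [|a| = sqrt r]. *)
Lemma odot_dec_rescale k j (a : 'M[C]_(k, j)) (v1 : 'M[E]_j) (v2 : 'M[F]_j)
    (b : 'M[C]_(j, k)) r :
  opnorm a * NE v1 * NF v2 * opnorm b < r ->
  odot_dec (lrmx a (otimes_odot theta v1 v2) b) r.
Proof.
have v10 := opspace_ge0 EO v1; have v20 := opspace_ge0 FO v2.
have a0 := opnorm_ge0 a; have b0 := opnorm_ge0 b => sr.
have r0 : 0 < r by apply: le_lt_trans sr; rewrite !mulr_ge0.
have [v1E|v1n] := eqVneq (NE v1) 0.
  by rewrite (opspace_eq0 EO v1E) otimes_odot0l lrmx0; apply: odot_dec0; apply: ltW.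
have [v2E|v2n] := eqVneq (NF v2) 0.
  by rewrite (opspace_eq0 FO v2E) otimes_odot0r lrmx0; apply: odot_dec0; apply: ltW.
(* The rescaling divides by [|v1|], [|v2|] and [|a|] but never by [|b|], so these are the only
   degenerate cases. *)
have [aE|an] := eqVneq (opnorm a) 0.
  have -> : a = 0 by apply: opnorm_le0_eq0; rewrite aE.
  rewrite (_ : lrmx _ _ _ = 0); first by apply: odot_dec0; apply: ltW.
  apply/matrixP => i l; rewrite lrmxE mxE big1 // => k1 _; rewrite big1 // => k2 _.
  by rewrite [X in X * _]mxE mul0r scale0r.
set n1 := NE v1 in v1n v10 sr *; set n2 := NF v2 in v2n v20 sr *.
set al := opnorm a in an a0 sr; set be := opnorm b in b0 sr.
have n1p : 0 < n1 by rewrite lt0r v1n.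
have n2p : 0 < n2 by rewrite lt0r v2n.
have alp : 0 < al by rewrite lt0r an.
have sp : 0 < Num.sqrt r by rewrite sqrtr_gt0.
(* [t'] is forced by [t * t' / (n1 * n2) = 1]; the new [b] has norm at most
   [al * n1 * n2 * be / sqrt r], which is below [sqrt r] by hypothesis. *)
pose t := Num.sqrt r / al; pose t' := n1 * n2 / t.
have tp : 0 < t by rewrite divr_gt0.
have t'p : 0 < t' by rewrite divr_gt0 // mulr_gt0.
exists j, (t%:C%C *: a), (map_mx (fun x => n1^-1%:C%C *: x) v1),
  (map_mx (fun x => n2^-1%:C%C *: x) v2), (t'%:C%C *: b); split.
- rewrite otimes_odotZ lrmx_map_scale lrmxZr !scalerA -!rmorphM.
  rewrite (_ : t' * (n1^-1 * n2^-1) * t = 1) ?scale1r //.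
  by rewrite /t'; field; rewrite v1n v2n gt_eqF.
- by rewrite (opspaceZ EO) cabs_real gtr0_norm ?invr_gt0 // mulVf.
- by rewrite (opspaceZ FO) cabs_real gtr0_norm ?invr_gt0 // mulVf.
- rewrite -[leRHS](sqr_sqrtr (ltW r0)) ler_sqr ?nnegrE ?opnorm_ge0 ?(ltW sp) //.
  apply: (le_trans (opnormZ _ _)); rewrite cabs_real gtr0_norm // -/al.
  by rewrite /t divfK.
- rewrite -[leRHS](sqr_sqrtr (ltW r0)) ler_sqr ?nnegrE ?opnorm_ge0 ?(ltW sp) //.
  apply: (le_trans (opnormZ _ _)); rewrite cabs_real gtr0_norm // -/be.
  rewrite -(ler_pM2l sp) -expr2 (sqr_sqrtr (ltW r0)).
  apply: le_trans (ltW sr); apply: eq_ler.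
  by rewrite /t' /t; field; rewrite an gt_eqF.
Qed.

(** The infimum need not be attained, hence the strict inequality: without a normalised
    decomposition of radius [r], every decomposition would cost at least [r]. *)
Lemma odot_dec_lt k (u : 'M[tens E F]_k) r :
  odot_repr theta u -> odotN u < r -> odot_dec u r.
Proof.
move=> ur Nr; have [//|nd] := pselect (odot_dec u r).
suff : r <= odotN u by rewrite leNgt Nr.
rewrite -[odotN u]mul1r; apply: le_odot_norm => // j a v1 v2 b uE.
by rewrite mul1r leNgt; apply/negP => /odot_dec_rescale; rewrite -uE.
Qed.

Lemma odot_decD k (u w : 'M[tens E F]_k) r r' : 0 < r -> 0 < r' ->
  odot_dec u r -> odot_dec w r' -> odot_dec (u + w) (r + r').
Proof.
move=> r0 r'0 [j [a [v1 [v2 [b [-> h1 h2 ha hb]]]]]].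
move=> [j' [a' [w1 [w2 [b' [-> h1' h2' ha' hb']]]]]].
exists (j + j')%N, (row_mx a a'), (block_mx v1 0 0 w1), (block_mx v2 0 0 w2).
exists (col_mx b b'); rewrite otimes_odot_block lrmx_row_col.
have rr : 0 <= r + r' by rewrite addr_ge0 ?ltW.
split=> //; rewrite ?opspace_block ?ge_max ?h1 ?h2 //.
  by apply: sqbounded_sqr_opnorm => //; apply: sqbounded_row => //;
    [apply: sqbounded_le ha _|apply: sqbounded_le ha' _]; apply: opnorm_sqbounded.
by apply: sqbounded_sqr_opnorm => //; apply: sqbounded_col => //;
    [apply: sqbounded_le hb _|apply: sqbounded_le hb' _]; apply: opnorm_sqbounded.
Qed.

Lemma odot_dec_block k n (u : 'M[tens E F]_k) (w : 'M[tens E F]_n) r : 0 <= r ->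
  odot_dec u r -> odot_dec w r -> odot_dec (block_mx u 0 0 w) r.
Proof.
move=> r0 [j [a [v1 [v2 [b [-> h1 h2 ha hb]]]]]].
move=> [j' [a' [w1 [w2 [b' [-> h1' h2' ha' hb']]]]]].
exists (j + j')%N, (block_mx a 0 0 a'), (block_mx v1 0 0 w1), (block_mx v2 0 0 w2).
exists (block_mx b 0 0 b'); rewrite otimes_odot_block lrmx_block.
split=> //; rewrite ?opspace_block ?ge_max ?h1 ?h2 //.
  by apply: sqbounded_sqr_opnorm => //; apply: sqbounded_block => //;
    [apply: sqbounded_le ha _|apply: sqbounded_le ha' _]; apply: opnorm_sqbounded.
by apply: sqbounded_sqr_opnorm => //; apply: sqbounded_block => //;
    [apply: sqbounded_le hb _|apply: sqbounded_le hb' _]; apply: opnorm_sqbounded.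
Qed.

Lemma odot_normD k (u w : 'M[tens E F]_k) :
  odot_repr theta u -> odot_repr theta w -> odotN (u + w) <= odotN u + odotN w.
Proof.
move=> ur wr; apply/ler_addgt0Pr => e e0.
have u0 := odot_norm_ge0 ur; have w0 := odot_norm_ge0 wr.
have -> : odotN u + odotN w + e = (odotN u + e / 2) + (odotN w + e / 2) by field.
(* The slack [e / 2] makes the bounds strict for [odot_dec_lt] and the radii positive for
   [odot_decD]. *)
have e2 : 0 < e / 2 by rewrite divr_gt0.
apply: odot_dec_le; apply: odot_decD; rewrite ?ltr_wpDl //.
  by apply: odot_dec_lt => //; rewrite ltrDl.
by apply: odot_dec_lt => //; rewrite ltrDl.
Qed.

Lemma odot_repr_block k n (u : 'M[tens E F]_k) (w : 'M[tens E F]_n) :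
  odot_repr theta u -> odot_repr theta w -> odot_repr theta (block_mx u 0 0 w).
Proof.
move=> [j [a [v1 [v2 [b ->]]]]] [j' [a' [w1 [w2 [b' ->]]]]].
exists (j + j')%N, (block_mx a 0 0 a'), (block_mx v1 0 0 w1), (block_mx v2 0 0 w2).
by exists (block_mx b 0 0 b'); rewrite otimes_odot_block lrmx_block.
Qed.

Lemma odot_norm_mxsub k n (f : 'I_k -> 'I_n) (u : 'M[tens E F]_n) :
  injective f -> odot_repr theta u -> odotN (mxsub f f u) <= odotN u.
Proof.
move=> fI ur; rewrite -(lrmx_sel (R := R)); apply: (le_trans (odot_norm_lrmx _ _ ur)).
have u0 := odot_norm_ge0 ur.
rewrite -[X in _ <= X]mulr1.
apply: ler_pM; rewrite ?opnorm_ge0 ?mulr_ge0 ?opnorm_ge0 ?opnorm_selmxT //.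
by rewrite -[X in _ <= X]mul1r; apply: ler_wpM2r => //; apply: opnorm_selmx.
Qed.

(** The upper bound adds decompositions of a common radius as direct sums; the lower bound
    compresses to the two diagonal corners. *)
Lemma odot_norm_block k n (u : 'M[tens E F]_k) (w : 'M[tens E F]_n) :
  odot_repr theta u -> odot_repr theta w ->
  odotN (block_mx u 0 0 w) = Num.max (odotN u) (odotN w).
Proof.
move=> ur wr; have br := odot_repr_block ur wr.
apply/eqP; rewrite eq_le; apply/andP; split.
  apply/ler_addgt0Pr => e e0; have u0 := odot_norm_ge0 ur.
  apply: odot_dec_le; apply: odot_dec_block.
  - by apply: addr_ge0; [rewrite le_max u0|apply: ltW].
  - by apply: odot_dec_lt => //; apply: ltr_pwDr => //; rewrite le_max lexx.
  - by apply: odot_dec_lt => //; apply: ltr_pwDr => //; rewrite le_max lexx orbT.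
rewrite ge_max; apply/andP; split.
  apply: le_trans (odot_norm_mxsub (@lshift_inj k n) br); apply: eq_ler.
  by congr odot_norm; apply/matrixP => i j; rewrite mxE block_mxEul.
apply: le_trans (odot_norm_mxsub (@rshift_inj k n) br); apply: eq_ler.
by congr odot_norm; apply/matrixP => i j; rewrite mxE block_mxEdr.
Qed.

End OdotNorm.

(** * Comparison with the minimal and projective norms *)

Section Minimal.
Variables (R : realType) (E F : lmodType R[i]).
Local Notation C := R[i].

(** The matrix [a (x) 1_p], through which scalar matrices act after [flat]. *)
Definition ampmx m n p (a : 'M[C]_(m, n)) : 'M[C]_(m * p, n * p) :=
  kron4 (fun i j k l => a i j * (k == l)%:R).

Lemma opnorm_ampmx m n p (a : 'M[C]_(m, n)) : opnorm (ampmx p a) <= opnorm a.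
Proof.
apply: sqbounded_opnorm; first exact: opnorm_ge0.
have := sqbounded_sub (@mxvec_pair_inj m p) (@mxvec_pair_inj n p)
  (sqbounded_amplify (L := 'I_p) (opnorm_sqbounded a)).
apply: eq_sqbounded => I J.
case/mxvec_indexP: I => i k; case/mxvec_indexP: J => j l.
by rewrite kron4E !mxvec_indexK.
Qed.

Lemma flat_lrmx m n n' m' p q (a : 'M[C]_(m, n)) (W : 'M['M[C]_(p, q)]_(n, n'))
    (b : 'M[C]_(n', m')) :
  flat (lrmx a W b) = ampmx p a *m flat W *m ampmx q b.
Proof.
apply/matrixP => I J; case/mxvec_indexP: I => i k; case/mxvec_indexP: J => j l.
rewrite kron4E lrmxE !mxE sum_mxvec_index exchange_big summxE.
apply: eq_bigr => s _; rewrite summxE [RHS](bigD1 l) //= [X in _ = _ + X]big1 ?addr0.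
  rewrite [X in _ = _ * X]kron4E eqxx mulr1 mxE sum_mxvec_index mulr_suml; apply: eq_bigr => r _.
  rewrite (bigD1 k) //= [X in _ = (_ + X) * _]big1 ?addr0.
    by rewrite !kron4E eqxx mulr1 mxE mulrAC.
  by move=> k' /negbTE kk; rewrite kron4E [k == _]eq_sym kk mulr0 !mul0r.
by move=> l' /negbTE ll; rewrite [X in _ * X]kron4E ll !mulr0.
Qed.

Lemma opnorm_flat_lrmx m n p q (a : 'M[C]_(m, n)) (W : 'M['M[C]_(p, q)]_n)
    (b : 'M[C]_(n, m)) :
  opnorm (flat (lrmx a W b)) <= opnorm a * opnorm (flat W) * opnorm b.
Proof.
rewrite flat_lrmx; apply: (le_trans (opnorm_mul _ _)).
apply: ler_pM; rewrite ?opnorm_ge0 ?opnorm_ampmx //.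
apply: (le_trans (opnorm_mul _ _)).
by apply: ler_pM; rewrite ?opnorm_ge0 ?opnorm_ampmx.
Qed.

Lemma linear_dual_tens p q (f : E -> 'M[C]_p) (g : F -> 'M[C]_q) :
  linear (dual_tens f g).
Proof.
move=> c s t; apply/matrixP => I J.
case/mxvec_indexP: I => i k; case/mxvec_indexP: J => j l.
by rewrite [RHS]mxE [X in _ = X + _]mxE !kron4E.
Qed.

Lemma islin_entry p (f : E -> 'M[C]_p) i j : linear f -> islin (fun x => f x i j).
Proof. by move=> fL c x y; rewrite fL !mxE. Qed.

End Minimal.

Section Comparison.
Variables (R : realType) (theta : R) (E F : lmodType R[i]).
Variables (NE : @mnorms R E) (NF : @mnorms R F).
Hypotheses (EO : opspace NE) (FO : opspace NF).
Local Notation C := R[i].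

(* With [A] and [B] the images of [v1] and [v2] acting on the first and second
   tensor leg, the image of [v1 (x)_odot v2] is [(1 - theta) A B + theta B A]. *)
Lemma opnorm_dual_otimes p q j (f : E -> 'M[C]_p) (g : F -> 'M[C]_q)
    (v1 : 'M[E]_j) (v2 : 'M[F]_j) :
  0 <= theta <= 1 -> linear f -> linear g ->
  opnorm (flat (map_mx (dual_tens f g) (otimes_odot theta v1 v2))) <=
  opnorm (flat (map_mx f v1)) * opnorm (flat (map_mx g v2)).
Proof.
move=> th fL gL.
set al := opnorm (flat (map_mx f v1)); set be := opnorm (flat (map_mx g v2)).
have inj2 m n : injective (fun x : 'I_m * 'I_n => mxvec_index x.1 x.2).
  by move=> [x1 x2] [y1 y2] /eqP; rewrite mxvec_index_eq => /andP[/eqP/= -> /eqP/= ->].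
(* [KA] is [f(v1) (x) 1_q] and [KB] is [g(v2) (x) 1_p], each with its idle leg last, as
   [sqbounded_amplify] expects. *)
pose KA (x y : ('I_j * 'I_p) * 'I_q) : C :=
  f (v1 x.1.1 y.1.1) x.1.2 y.1.2 * (x.2 == y.2)%:R.
pose KB (x y : ('I_j * 'I_q) * 'I_p) : C :=
  g (v2 x.1.1 y.1.1) x.1.2 y.1.2 * (x.2 == y.2)%:R.
have bA : sqbounded KA (al ^+ 2).
  apply: (sqbounded_amplify (K := fun x y : 'I_j * 'I_p => f (v1 x.1 y.1) x.2 y.2)).
  have := sqbounded_sub (@inj2 j p) (@inj2 j p) (opnorm_sqbounded (flat (map_mx f v1))).
  by apply: eq_sqbounded => x y; rewrite kron4E mxE.
have bB : sqbounded KB (be ^+ 2).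
  apply: (sqbounded_amplify (K := fun x y : 'I_j * 'I_q => g (v2 x.1 y.1) x.2 y.2)).
  have := sqbounded_sub (@inj2 j q) (@inj2 j q) (opnorm_sqbounded (flat (map_mx g v2))).
  by apply: eq_sqbounded => x y; rewrite kron4E mxE.
(* [ha] and [hb] reorder the legs so that both kernels act on the common index set [j * (p * q)] and
   can be composed. *)
pose ha (I : 'I_(j * (p * q))) := let: (i, K) := mxvec_pair I in
  let: (s, t) := mxvec_pair K in ((i, s), t).
pose hb (I : 'I_(j * (p * q))) := let: (i, K) := mxvec_pair I in
  let: (s, t) := mxvec_pair K in ((i, t), s).
have haE i s t : ha (mxvec_index i (mxvec_index s t)) = ((i, s), t).
  by rewrite /ha !mxvec_indexK.
have hbE i s t : hb (mxvec_index i (mxvec_index s t)) = ((i, t), s).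
  by rewrite /hb !mxvec_indexK.
have haI : injective ha.
  move=> I J; case/mxvec_indexP: I => i K; case/mxvec_indexP: K => s t.
  case/mxvec_indexP: J => i' K; case/mxvec_indexP: K => s' t'.
  by rewrite !haE => -[-> -> ->].
have hbI : injective hb.
  move=> I J; case/mxvec_indexP: I => i K; case/mxvec_indexP: K => s t.
  case/mxvec_indexP: J => i' K; case/mxvec_indexP: K => s' t'.
  by rewrite !hbE => -[-> -> ->].
apply: sqbounded_opnorm; first by rewrite mulr_ge0 ?opnorm_ge0.
have bA' := sqbounded_sub haI haI bA; have bB' := sqbounded_sub hbI hbI bB.
have bAB := sqbounded_comp (sqr_ge0 _) bA' bB'.
have bBA := sqbounded_comp (sqr_ge0 _) bB' bA'.
rewrite mulrC in bBA; rewrite exprMn.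
apply: eq_sqbounded (sqbounded_convex th bAB bBA) => I J.
case/mxvec_indexP: I => i K; case/mxvec_indexP: K => s t.
case/mxvec_indexP: J => i' K; case/mxvec_indexP: K => s' t'.
rewrite kron4E mxE kron4E otimes_odotE tensD !tensZ !tens_sum.
congr (_ * _ + _ * _); rewrite sum_mxvec_index; apply: eq_bigr => k _;
  rewrite sum_mxvec_index tens_elE; try exact: islin_entry.
(* The idle legs leave one intermediate index per [k]: [(s', t)] in the product [A B], and [(s, t')]
   in [B A] below. *)
- rewrite (bigD1 s') //= [X in _ + X]big1 ?addr0 => [|s0 /negbTE ss].
    rewrite (bigD1 t) //= big1 ?addr0 => [|t0 /negbTE tt].
      by rewrite !haE !hbE /KA /KB /= !eqxx !mulr1.
    by rewrite !haE /KA /= [t == _]eq_sym tt mulr0 mul0r.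
  by rewrite big1 // => t0 _; rewrite !hbE /KB /= ss !mulr0.
- rewrite (bigD1 s) //= [X in _ + X]big1 ?addr0 => [|s0 /negbTE ss].
    rewrite (bigD1 t') //= big1 ?addr0 => [|t0 /negbTE tt].
      by rewrite !haE !hbE /KA /KB /= !eqxx !mulr1 mulrC.
    by rewrite !haE /KA /= tt !mulr0.
  by rewrite big1 // => t0 _; rewrite !hbE /KB /= [s == _]eq_sym ss mulr0 mul0r.
Qed.

Lemma dual_ball_le (V : lmodType C) (N : @mnorms R V) p (f : V -> 'M[C]_p) n (v : 'M[V]_n) :
  opspace N -> dual_ball N f -> opnorm (flat (map_mx f v)) <= N n v.
Proof.
move=> NO [fL fb f1].
have Z n' (c : C) (w : 'M['M[C]_p]_n') :
    Mp_norms (map_mx (fun x => c *: x) w) <= cabs c * Mp_norms w.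
  apply: le_trans (opnormZ _ _); apply: eq_ler; congr opnorm.
  apply/matrixP => I J; rewrite [RHS]mxE.
  case/mxvec_indexP: I => i k; case/mxvec_indexP: J => j l.
  by rewrite !kron4E !mxE.
apply: (le_trans (cbnorm_le NO v Z fL fb)).
by rewrite ler_piMl // opspace_ge0.
Qed.

(** Kept for a single pair [f], [g] instead of the supremum, because definiteness evaluates it at
    scalar functionals. *)
Lemma odot_dual_le p q (f : E -> 'M[C]_p) (g : F -> 'M[C]_q) k (u : 'M[tens E F]_k) :
  0 <= theta <= 1 -> odot_repr theta u -> dual_ball NE f -> dual_ball NF g ->
  opnorm (flat (map_mx (dual_tens f g) u)) <= odot_norm theta NE NF u.
Proof.
move=> th ur fB gB; rewrite -[odot_norm _ _ _ _]mul1r.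
apply: le_odot_norm => // j a v1 v2 b ->; rewrite mul1r map_lrmx; last first.
  exact: linear_dual_tens.
apply: (le_trans (opnorm_flat_lrmx _ _ _)).
apply: ler_wpM2r; first exact: opnorm_ge0.
rewrite -mulrA; apply: ler_wpM2l; first exact: opnorm_ge0.
have [fL _ _] := fB; have [gL _ _] := gB.
apply: (le_trans (opnorm_dual_otimes _ _ th fL gL)).
by apply: ler_pM; rewrite ?opnorm_ge0 ?dual_ball_le.
Qed.

Lemma min_le_odot k (u : 'M[tens E F]_k) :
  0 <= theta <= 1 -> odot_repr theta u ->
  min_norm NE NF u <= odot_norm theta NE NF u.
Proof.
move=> th ur; rewrite /min_norm; set A := [set r | _].
(* [ge_sup] wants a nonempty set; the split saves exhibiting a pair of functionals, as [sup] of the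
   empty set is 0. *)
have [->|/set0P A0] := eqVneq A set0; first by rewrite sup0 odot_norm_ge0.
apply: ge_sup => // _ [p [q [f [g [fB gB ->]]]]].
exact: odot_dual_le.
Qed.

(** [functional_cbounded] bounds all matrix levels; what remains is to identify the indices [n * 1]
    with [n]. *)
Lemma dual_ball_functional (V : lmodType C) (N : @mnorms R V) (f : V -> C) :
  opspace N -> islin f -> (forall x, cabs (f x) <= N 1%N (const_mx x)) ->
  dual_ball N (fun x => const_mx (f x) : 'M_1).
Proof.
move=> NO fL fN.
have H n (v : 'M[V]_n) :
    Mp_norms (map_mx (fun x => const_mx (f x) : 'M_1) v) <= N n v.
  apply: le_trans (functional_cbounded NO v fL fN).
  apply: sqbounded_opnorm; first exact: opnorm_ge0.
  have pI : injective (fun I : 'I_(n * 1) => (mxvec_pair I).1).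
    move=> I J; case/mxvec_indexP: I => i k; case/mxvec_indexP: J => j l.
    by rewrite !mxvec_indexK /= !ord1 => ->.
  have := sqbounded_sub pI pI (opnorm_sqbounded (map_mx f v)).
  apply: eq_sqbounded => I J.
  case/mxvec_indexP: I => i k; case/mxvec_indexP: J => j l.
  by rewrite kron4E !mxvec_indexK !mxE.
split.
- by move=> c x y; apply/matrixP => i j; rewrite !mxE fL.
- by exists 1 => n v _; rewrite mul1r.
- apply: ge_sup; last by move=> _ [n [v [_ v1 ->]]]; apply: le_trans v1.
  exists (Mp_norms (map_mx (fun x => const_mx (f x) : 'M_1) (0 : 'M[V]_0))), 0%N, 0.
  by split=> //; rewrite (opspace0 NO).
Qed.

Lemma functionals_separate (V : lmodType C) (N : @mnorms R V) (z : V) : opspace N ->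
  (forall f, islin f -> (forall x, cabs (f x) <= N 1%N (const_mx x)) -> f z = 0) ->
  z = 0.
Proof.
move=> NO H.
have [x y|c x|f [fL fN fz]] :=
    @hahn_banach_separation R V (fun x => N 1%N (const_mx x)) z.
- rewrite (_ : const_mx (x + y) = const_mx x + const_mx y); first exact: opspaceD.
  by apply/matrixP => i j; rewrite !mxE.
- rewrite -(opspaceZ NO); congr (N _ _).
  by apply/matrixP => i j; rewrite !mxE.
have /(opspace_eq0 NO)/matrixP/(_ 0 0) : N 1%N (const_mx z) = 0.
  by apply/eqP; rewrite eq_le opspace_ge0 // andbT fz // H.
by rewrite !mxE.
Qed.

Lemma intens_nonlin (t : tens E F) f g :
  intens t -> ~ (islin f /\ islin g) -> t f g = 0.
Proof.
move=> tI n; elim/intens_ind: t / tI => [//|x y|c s t hs ht].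
  exact: tens_el_nonlin.
by rewrite tensD tensZ hs ht mulr0 addr0.
Qed.

(** The vector [z] is [(id (x) g)(t)]. Being a finite sum of elementary tensors is what makes the
    partial application of [t] an evaluation at a point of [E]. *)
Lemma intens_contractl (t : tens E F) g : intens t -> islin g ->
  exists z : E, forall f, islin f -> t f g = f z.
Proof.
move=> tI gL; elim/intens_ind: t / tI => [|x y|c s t [z hz] [z' hz']].
- by exists 0 => f fL; rewrite islin0.
- by exists (g y *: x) => f fL; rewrite tens_elE // islinZ // mulrC.
- by exists (c *: z + z') => f fL; rewrite tensD tensZ hz // hz' // fL.
Qed.

Lemma intens_contractr (t : tens E F) f : intens t -> islin f ->
  exists z : F, forall g, islin g -> t f g = g z.
Proof.
move=> tI fL; elim/intens_ind: t / tI => [|x y|c s t [z hz] [z' hz']].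
- by exists 0 => g gL; rewrite islin0.
- by exists (f x *: y) => g gL; rewrite tens_elE // islinZ.
- by exists (c *: z + z') => g gL; rewrite tensD tensZ hz // hz' // gL.
Qed.

(* Bounded functionals separate points of [E] and of [F]; contracting one leg at
   a time shows that they also separate points of the tensor product. *)
Lemma intens_separate (t : tens E F) : intens t ->
  (forall f g, islin f -> islin g ->
     (forall x, cabs (f x) <= NE (const_mx x : 'M_1)) ->
     (forall y, cabs (g y) <= NF (const_mx y : 'M_1)) -> t f g = 0) ->
  t = 0.
Proof.
move=> tI H.
have H1 f g : islin f -> islin g ->
    (forall y, cabs (g y) <= NF (const_mx y : 'M_1)) -> t f g = 0.
  move=> fL gL gN; have [z tz] := intens_contractl tI gL.
  rewrite tz // (_ : z = 0) ?islin0 //.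
  by apply: (functionals_separate EO) => f' f'L f'N; rewrite -tz //; apply: H.
apply: tens_ext => [f g fL gL|f g n]; last exact: intens_nonlin.
have [z tz] := intens_contractr tI fL.
rewrite tz // (_ : z = 0) ?islin0 //.
by apply: (functionals_separate FO) => g' g'L g'N; rewrite -tz //; apply: H1.
Qed.

Lemma odot_norm_eq0 k (u : 'M[tens E F]_k) :
  0 <= theta <= 1 -> (forall i j, intens (u i j)) ->
  odot_norm theta NE NF u = 0 -> u = 0.
Proof.
move=> th uI u0; apply/matrixP => i j; rewrite [RHS]mxE.
apply: intens_separate => // f g fL gL fN gN.
have fB := dual_ball_functional EO fL fN; have gB := dual_ball_functional FO gL gN.
have := odot_dual_le th (odot_repr_intens theta uI) fB gB.
rewrite u0 => /opnorm_le0_eq0/matrixP.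
move=> /(_ (mxvec_index i (mxvec_index 0 0)) (mxvec_index j (mxvec_index 0 0))).
rewrite kron4E mxE kron4E [RHS]mxE => <-.
by congr (u i j _ _); apply: funext => x; rewrite mxE.
Qed.

Lemma opspace_on_odot : 0 <= theta <= 1 ->
  opspace_on (@intens R E F) (odot_norm theta NE NF).
Proof.
move=> th; split.
- move=> n v w /[dup] vI /(odot_repr_intens theta) vr /(odot_repr_intens theta) wr.
  split; [exact: odot_norm_eq0|move=> c; exact: odot_normZ|exact: odot_normD].
- by move=> m n a v b /(odot_repr_intens theta); apply: odot_norm_lrmx.
- move=> n m v w /(odot_repr_intens theta) vr /(odot_repr_intens theta) wr.
  exact: odot_norm_block.
Qed.

(* [x (x) 1] and [1 (x) y] commute, so [odot] multiplies them to [x (x) y]. *)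
Lemma mxtens_odot p q (x : 'M[E]_p) (y : 'M[F]_q) :
  mxtens x y = otimes_odot theta
    (kron4 (fun i j (k l : 'I_q) => if k == l then x i j else 0))
    (kron4 (fun (i j : 'I_p) k l => if i == j then y k l else 0)).
Proof.
apply/matrixP => I J; case/mxvec_indexP: I => i k; case/mxvec_indexP: J => j l.
rewrite otimes_odotE kron4E !sum_mxvec_index.
rewrite [X in _ = _ *: X + _](_ : _ = tens_el (x i j) (y k l)); last first.
  rewrite (bigD1 j) //= [X in _ + X]big1 ?addr0 => [|j' /negbTE jj].
    rewrite (bigD1 k) //= big1 ?addr0 => [|k' /negbTE kk].
      by rewrite !kron4E !eqxx.
    by rewrite kron4E [k == _]eq_sym kk tens_el0l.
  by rewrite big1 // => k' _; rewrite [X in tens_el _ X]kron4E jj tens_el0r.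
rewrite [X in _ = _ + _ *: X](_ : _ = tens_el (x i j) (y k l)).
  by rewrite -scalerDl -rmorphD /= subrK scale1r.
rewrite (bigD1 i) //= [X in _ + X]big1 ?addr0 => [|i' /negbTE ii].
  rewrite (bigD1 l) //= big1 ?addr0 => [|l' /negbTE ll].
    by rewrite !kron4E !eqxx.
  by rewrite kron4E ll tens_el0l.
by rewrite big1 // => l' _; rewrite [X in tens_el _ X]kron4E [i == _]eq_sym ii tens_el0r.
Qed.

Definition proj_repr k (u : 'M[tens E F]_k) : Prop :=
  exists p q (x : 'M[E]_p) (y : 'M[F]_q) (a : 'M[C]_(k, p * q)) (b : 'M[C]_(p * q, k)),
    u = lrmx a (mxtens x y) b.

(** The tensor product of the direct sums of [x, x'] and [y, y'] also contains the cross terms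
    [x (x) y'] and [x' (x) y]; [h] selects the indices of the two wanted blocks. *)
Lemma proj_reprD n (u w : 'M[tens E F]_n) :
  proj_repr u -> proj_repr w -> proj_repr (u + w).
Proof.
move=> [p [q [x [y [a [b ->]]]]]] [p' [q' [x' [y' [a' [b' ->]]]]]].
pose h (I : 'I_(p * q + p' * q')) : 'I_((p + p') * (q + q')) :=
  match fintype.split I with
  | inl K => mxvec_index (lshift p' (mxvec_pair K).1) (lshift q' (mxvec_pair K).2)
  | inr K => mxvec_index (rshift p (mxvec_pair K).1) (rshift q (mxvec_pair K).2)
  end.
have hl i k : h (lshift _ (mxvec_index i k)) = mxvec_index (lshift p' i) (lshift q' k).
  by rewrite /h (unsplitK (inl _)) mxvec_indexK.
have hr i k : h (rshift _ (mxvec_index i k)) = mxvec_index (rshift p i) (rshift q k).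
  by rewrite /h (unsplitK (inr _)) mxvec_indexK.
have hE : mxsub h h (mxtens (block_mx x 0 0 x') (block_mx y 0 0 y')) =
    block_mx (mxtens x y) 0 0 (mxtens x' y').
  apply/matrixP => I J; rewrite [LHS]mxE.
  case: (split_ordP I) => K ->; case: (split_ordP J) => L ->;
    case/mxvec_indexP: K => i k; case/mxvec_indexP: L => j l; rewrite ?(hl, hr) kron4E.
  - by rewrite !block_mxEul kron4E.
  - by rewrite !block_mxEur !mxE tens_el0l.
  - by rewrite !block_mxEdl !mxE tens_el0l.
  - by rewrite !block_mxEdr kron4E.
exists (p + p')%N, (q + q')%N, (block_mx x 0 0 x'), (block_mx y 0 0 y').
exists (row_mx a a' *m selmx R h), ((selmx R h)^T *m col_mx b b').
rewrite -[RHS]lrmx_comp lrmx_sel hE.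
by rewrite lrmx_row_col.
Qed.

Lemma proj_repr_intens k (u : 'M[tens E F]_k) :
  (forall i j, intens (u i j)) -> proj_repr u.
Proof.
apply: (mx_intens_ind (P := proj_repr)).
- exact: proj_reprD.
- move=> k' n a w b [p [q [x [y [a' [b' ->]]]]]]; rewrite lrmx_comp.
  by exists p, q, x, y, (a *m a'), (b' *m b).
- move=> x y; exists 1%N, 1%N, (const_mx x), (const_mx y), (1 *: 1%:M), 1%:M.
  rewrite lrmx_scalar; apply/matrixP => i j; rewrite [RHS]mxE scale1r [LHS]mxE.
  have ij (I : 'I_1) : I = mxvec_index (0 : 'I_1) (0 : 'I_1).
    by rewrite [LHS]ord1 [RHS]ord1.
  rewrite (ij i) (ij j); apply: esym; apply: etrans (kron4E _ 0 0 0 0) _.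
  by rewrite !mxE.
Qed.

(** Each projective decomposition becomes an [odot] decomposition at no greater cost, since
    amplification by an identity does not increase the norm. *)
Lemma odot_le_proj k (u : 'M[tens E F]_k) : (forall i j, intens (u i j)) ->
  odot_norm theta NE NF u <= proj_norm NE NF u.
Proof.
move=> /proj_repr_intens [p [q [x [y [a [b uE]]]]]].
apply: lb_le_inf.
  by exists (opnorm a * NE x * NF y * opnorm b), p, q, x, y, a, b.
move=> _ [p' [q' [x' [y' [a' [b' [-> ->]]]]]]].
rewrite mxtens_odot; apply: (le_trans (odot_norm_le _ EO FO _ _ _ _)).
apply: ler_wpM2r; first exact: opnorm_ge0.
rewrite -!mulrA; apply: ler_wpM2l; first exact: opnorm_ge0.
by apply: ler_pM; rewrite ?opspace_ge0 ?opspace_amplify ?opspace_amplifyl.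
Qed.

End Comparison.

(** * Functoriality *)

Section Functoriality.
Variables (R : realType) (theta : R) (E1 E2 F1 F2 : lmodType R[i]).
Variables (NE1 : @mnorms R E1) (NE2 : @mnorms R E2).
Variables (NF1 : @mnorms R F1) (NF2 : @mnorms R F2).
Variables (S : E1 -> E2) (T : F1 -> F2).
Hypotheses (E1O : opspace NE1) (E2O : opspace NE2).
Hypotheses (F1O : opspace NF1) (F2O : opspace NF2).
Hypotheses (SL : linear S) (TL : linear T).

Lemma linear_tensmap : linear (tensmap S T).
Proof.
move=> c s t; apply: funext => f; apply: funext => g.
rewrite tensD tensZ /tensmap; case: asboolP => _ //.
by rewrite mulr0 addr0.
Qed.

Lemma tensmap_el x y : tensmap S T (tens_el x y) = tens_el (S x) (T y).
Proof.
apply: tens_ext => [f g fL gL|f g n]; rewrite /tensmap; last first.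
  by rewrite asboolF // tens_el_nonlin.
rewrite asboolT // !tens_elE // => c u v /=; first by rewrite SL fL.
by rewrite TL gL.
Qed.

Lemma map_tensmap_otimes n (v1 : 'M[E1]_n) (v2 : 'M[F1]_n) :
  map_mx (tensmap S T) (otimes_odot theta v1 v2) =
  otimes_odot theta (map_mx S v1) (map_mx T v2).
Proof.
apply/matrixP => i j; rewrite [LHS]mxE !otimes_odotE.
rewrite linear_tensmap (scalable_linear linear_tensmap).
rewrite !(linear_fun_sum _ linear_tensmap).
by congr (_ *: _ + _ *: _); apply: eq_bigr => k _; rewrite tensmap_el !mxE.
Qed.

Hypotheses (Sb : cbounded NE1 NE2 S) (Tb : cbounded NF1 NF2 T).

(** [S] and [T] applied entrywise carry a decomposition of [u] to one of its image, with the same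
    [a] and [b]. *)
Lemma odot_norm_tensmap k (u : 'M[tens E1 F1]_k) : odot_repr theta u ->
  odot_norm theta NE2 NF2 (map_mx (tensmap S T) u) <=
  cbnorm NE1 NE2 S * cbnorm NF1 NF2 T * odot_norm theta NE1 NF1 u.
Proof.
have S0 : 0 <= cbnorm NE1 NE2 S.
  by apply: cbnorm_ge0 => // n w; apply: opspace_ge0.
have T0 : 0 <= cbnorm NF1 NF2 T.
  by apply: cbnorm_ge0 => // n w; apply: opspace_ge0.
move=> ur; apply: le_odot_norm => // [|j a v1 v2 b ->]; first by rewrite mulr_ge0.
rewrite map_lrmx; last exact: linear_tensmap.
rewrite map_tensmap_otimes; apply: (le_trans (odot_norm_le _ E2O F2O _ _ _ _)).
rewrite mulrA; apply: ler_wpM2r; first exact: opnorm_ge0.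
have -> : cbnorm NE1 NE2 S * cbnorm NF1 NF2 T * (opnorm a * NE1 v1 * NF1 v2) =
  opnorm a * ((cbnorm NE1 NE2 S * NE1 v1) * (cbnorm NF1 NF2 T * NF1 v2)) by ring.
rewrite -mulrA; apply: ler_wpM2l; first exact: opnorm_ge0.
apply: ler_pM; rewrite ?opspace_ge0 //; apply: cbnorm_le => // n c w.
  by rewrite (opspaceZ E2O).
by rewrite (opspaceZ F2O).
Qed.

(** Complements the bound on [cbnorm_on]: a real supremum has a default value on unbounded sets, so
    that bound does not by itself express boundedness. *)
Lemma cbounded_tensmap :
  cbounded_on (@intens R E1 F1) (odot_norm theta NE1 NF1) (odot_norm theta NE2 NF2)
    (tensmap S T).
Proof.
exists (cbnorm NE1 NE2 S * cbnorm NF1 NF2 T) => n v vI.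
by apply: odot_norm_tensmap; apply: odot_repr_intens.
Qed.

Lemma cbnorm_tensmap :
  cbnorm_on (@intens R E1 F1) (odot_norm theta NE1 NF1) (odot_norm theta NE2 NF2)
    (tensmap S T) <= cbnorm NE1 NE2 S * cbnorm NF1 NF2 T.
Proof.
apply: ge_sup.
  (* The empty matrix lies in the unit ball, so the supremum is over a nonempty set. *)
  exists (odot_norm theta NE2 NF2 (map_mx (tensmap S T) (0 : 'M_0))), 0%N, 0.
  split=> [[]//||//].
  by apply: odot_dec_le => //; apply: odot_dec0.
move=> _ [n [v [vI v1 ->]]].
apply: (le_trans (odot_norm_tensmap (odot_repr_intens theta vI))).
apply: ler_piMr => //; rewrite mulr_ge0 //.
  by apply: cbnorm_ge0 => // m w; apply: opspace_ge0.
by apply: cbnorm_ge0 => // m w; apply: opspace_ge0.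
Qed.

End Functoriality.

Theorem theorem2p8 (R : realType) (theta : R) :
  0 <= theta <= 1 ->
  (* (odot^theta)_k define an operator space structure on E (x) F *)
  (forall (E F : lmodType R[i]) (NE : mnorms E) (NF : mnorms F),
     opspace NE -> opspace NF ->
     opspace_on (@intens R E F) (odot_norm theta NE NF)) /\
  (* proj -> odot -> min identities are complete contractions *)
  (forall (E F : lmodType R[i]) (NE : mnorms E) (NF : mnorms F),
     opspace NE -> opspace NF ->
     ccontraction_on (@intens R E F) (proj_norm NE NF) (odot_norm theta NE NF) id /\
     ccontraction_on (@intens R E F) (odot_norm theta NE NF) (min_norm NE NF) id) /\
  (* cb-norm estimate for S (x) T *)
  (forall (E1 E2 F1 F2 : lmodType R[i]) (NE1 : mnorms E1) (NE2 : mnorms E2)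
          (NF1 : mnorms F1) (NF2 : mnorms F2) (S : E1 -> E2) (T : F1 -> F2),
     opspace NE1 -> opspace NE2 -> opspace NF1 -> opspace NF2 ->
     linear S -> linear T -> cbounded NE1 NE2 S -> cbounded NF1 NF2 T ->
     cbounded_on (@intens R E1 F1) (odot_norm theta NE1 NF1) (odot_norm theta NE2 NF2)
       (tensmap S T) /\
     cbnorm_on (@intens R E1 F1) (odot_norm theta NE1 NF1) (odot_norm theta NE2 NF2)
       (tensmap S T) <= cbnorm NE1 NE2 S * cbnorm NF1 NF2 T).
Proof.
move=> th; split; [|split].
- by move=> E F NE NF EO FO; apply: opspace_on_odot.
- move=> E F NE NF EO FO; split=> n v vI; rewrite map_mx_id //.
    exact: odot_le_proj.
  by apply: min_le_odot => //; apply: odot_repr_intens.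
- move=> E1 E2 F1 F2 NE1 NE2 NF1 NF2 S T E1O E2O F1O F2O SL TL Sb Tb.
  by split; [apply: cbounded_tensmap|apply: cbnorm_tensmap].
Qed.
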